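(* Let $\Gamma$ be a finitely generated discrete group with finite symmetric generating set $Q$, let $Z\subseteq\mathrm{Sub}(\Gamma)$ be a uniformly recurrent subgroup, and let $H\in Z$. Then the Schreier graph $S_\Gamma^Q(H)$ has local property A if and only if the groupoid $\mathcal{G}_H$ is topologically amenable.
   Context: Word length $l(\gamma)$ is taken with respect to $Q$. $\mathrm{Sub}(\Gamma)$ is the space of subgroups of $\Gamma$ with the topology of pointwise convergence of indicator functions, with $\Gamma$ acting by conjugation. A uniformly recurrent subgroup (URS) is a nonempty closed $\Gamma$-invariant subset $Z\subseteq\mathrm{Sub}(\Gamma)$ on which every $\Gamma$-orbit is dense. The Schreier graph $S=S_\Gamma^Q(H)$ is the rooted labeled graph with vertex set $\Gamma/H$, root $H$, and for each $\gamma H$ and $q\in Q$ an edge from $\gamma H$ to $q\gamma H$ labeled $q$; $d$ is the path metric and $B_n(x)=B_n(S,x)$ the ball of radius $n$ around $x$; root-label isomorphism means graph isomorphism preserving roots and labels. Local property A: $S$ has local property A if there are maps $\rho^n:\Gamma/H\to\ell^2(\Gamma/H)$, $x\mapsto\rho^n_x$ ($n\ge1$), with $\|\rho^n_x\|_2=1$ for all $x$, $\|\rho^n_x-\rho^n_y\|_2\le 1/n$ whenever $d(x,y)\le n$, and each $\rho^n$ local: there is $R_n>0$ such that $\rho^n_x$ is supported in $B_{R_n}(x)$ and whenever $\theta:B_{R_n}(x)\to B_{R_n}(y)$ is a root-label isomorphism (roots $x$, $y$), $\rho^n_y\circ\theta=\rho^n_x$. The groupoid $\mathcal{G}_H$: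 for $p\in\Gamma/H$, $n\ge0$ let $[p]_n$ be the root-label isomorphism class of $(B_n(S,p),p)$; $E_n=\{[p]_n\}$ (finite, discrete) with maps $[p]_{n+1}\mapsto[p]_n$; $\mathcal{G}_H^0=\varprojlim E_n$. For $x=(x_n)\in\mathcal{G}_H^0$ choose $p_n$ with $x_n=[p_n]_n$. Arrows are classes of pairs $(x,\gamma)$, $x\in\mathcal{G}_H^0$, $\gamma\in\Gamma$, with $(x,\gamma)\sim(x,\gamma')$ iff $\gamma p_n=\gamma'p_n$ for all large $n$. Range $r(x,\gamma)=x$, source $\gamma.x$ with $(\gamma.x)_n=[\gamma p_{n+l(\gamma)}]_n$, product $(x,\gamma')(\gamma'.x,\gamma)=(x,\gamma\gamma')$, inverse $(\gamma.x,\gamma^{-1})$, units $(x,e)$. The topology is generated by the sets $\{(x,\gamma): x_N=c\}$ for $N\in\mathbb{N}$, $c\in E_N$, $l(\gamma)\le N$, making $\mathcal{G}_H$ a Hausdorff étale groupoid. Topological amenability is in the sense of Anantharaman-Delaroche and Renault. *)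

(* Defs.v *)
From Stdlib Require Import Reals List Classical ClassicalEpsilon.
Import ListNotations.

Set Implicit Arguments.
Unset Strict Implicit.

Record grp := Grp {
  carrier :> Type;
  mul : carrier -> carrier -> carrier;
  inv : carrier -> carrier;
  one : carrier;
  mulA : forall x y z, mul x (mul y z) = mul (mul x y) z;
  mul1g : forall x, mul one x = x;
  mulg1 : forall x, mul x one = x;
  mulVg : forall x, mul (inv x) x = one;
  mulgV : forall x, mul x (inv x) = one
}.

Arguments mul {g}.
Arguments inv {g}.
Arguments one {g}.

Section Defs.
Variable Γ : grp.

Definition prod_word (w : list Γ) : Γ := fold_right mul one w.

Definition word_in (Q : list Γ) (w : list Γ) : Prop := Forall (fun q => In q Q) w.

Definition finite_symmetric_generating (Q : list Γ) : Prop :=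
  (forall q, In q Q -> In (inv q) Q) /\
  (forall g : Γ, exists w, word_in Q w /\ prod_word w = g).

Definition is_wordlen (Q : list Γ) (g : Γ) (k : nat) : Prop :=
  (exists w, word_in Q w /\ length w = k /\ prod_word w = g) /\
  (forall w, word_in Q w -> prod_word w = g -> (k <= length w)%nat).

Definition wordlen (Q : list Γ) (g : Γ) : nat :=
  epsilon (inhabits 0%nat) (fun k => is_wordlen Q g k).

Definition subgroup (K : Γ -> Prop) : Prop :=
  K one /\ (forall x y, K x -> K y -> K (mul x y)) /\ (forall x, K x -> K (inv x)).

Definition conjsub (γ : Γ) (K : Γ -> Prop) : Γ -> Prop :=
  fun g => K (mul (inv γ) (mul g γ)).

(* Sub(Γ) carries the topology of pointwise convergence of indicator
   functions (product topology on {0,1}^Γ): basic neighbourhoods of L are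
   given by a finite set F ⊆ Γ, namely {K | K ∩ F = L ∩ F}. *)
Definition in_closure (Z : (Γ -> Prop) -> Prop) (L : Γ -> Prop) : Prop :=
  forall F : list Γ, exists K, Z K /\ forall g, In g F -> (K g <-> L g).

Definition URS (Z : (Γ -> Prop) -> Prop) : Prop :=
  (forall K, Z K -> subgroup K) /\
  (exists K, Z K) /\
  (forall L, subgroup L -> in_closure Z L -> Z L) /\
  (forall K γ, Z K -> Z (conjsub γ K)) /\
  (forall K L, Z K -> Z L -> in_closure (fun M => exists γ, M = conjsub γ K) L).

(* The Schreier graph S = S^Q_Γ(H).  A vertex γH is represented by γ;  *)
(* ceq H u v  <->  uH = vH.  Edges: γH --q--> qγH, q ∈ Q.             *)
Variable Q : list Γ.
Variable H : Γ -> Prop.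

Definition ceq (u v : Γ) : Prop := H (mul (inv u) v).

(* d(uH, vH) <= k  (Q symmetric, so directed and undirected paths agree) *)
Definition dist_le (u v : Γ) (k : nat) : Prop :=
  exists w, word_in Q w /\ (length w <= k)%nat /\ ceq (mul (prod_word w) u) v.

Definition in_ball (r : R) (u v : Γ) : Prop :=
  exists k : nat, (INR k <= r)%R /\ dist_le u v k.

Definition root_label_iso (r : R) (u v : Γ) (θ : Γ -> Γ) : Prop :=
  (forall a b, in_ball r u a -> ceq a b -> ceq (θ a) (θ b)) /\
  (forall a, in_ball r u a -> in_ball r v (θ a)) /\
  ceq (θ u) v /\
  (forall a b, in_ball r u a -> in_ball r u b -> ceq (θ a) (θ b) -> ceq a b) /\
  (forall b, in_ball r v b -> exists a, in_ball r u a /\ ceq (θ a) b) /\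
  (forall a b q, in_ball r u a -> in_ball r u b -> In q Q ->
     (ceq (mul q a) b <-> ceq (mul q (θ a)) (θ b))).

Definition iso_cls (n : nat) (u v : Γ) : Prop :=
  exists θ, root_label_iso (INR n) u v θ.

End Defs.

Fixpoint lsum {T : Type} (f : T -> R) (l : list T) : R :=
  match l with nil => 0%R | x :: l' => (f x + lsum f l')%R end.

(* s = Σ_{[t] ∈ A/eqv} f t  for f ≥ 0 (supremum of finite partial sums
   over families of pairwise inequivalent elements of A) *)
Definition sum_nonneg {T : Type} (A : T -> Prop) (eqv : T -> T -> Prop)
    (f : T -> R) (s : R) : Prop :=
  is_lub (fun r => exists l, Forall A l /\
            ForallOrdPairs (fun a b => ~ eqv a b) l /\ r = lsum f l) s.

Definition sum_signed {T : Type} (A : T -> Prop) (eqv : T -> T -> Prop)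
    (f : T -> R) (s : R) : Prop :=
  exists s1 s2, sum_nonneg A eqv (fun t => Rmax (f t) 0) s1 /\
                sum_nonneg A eqv (fun t => Rmax (- f t) 0) s2 /\ s = (s1 - s2)%R.

Section Main.
Variable Γ : grp.
Variable Q : list Γ.
Variable H : Γ -> Prop.

Local Notation ceq := (ceq H).
Local Notation dist_le := (dist_le Q H).
Local Notation in_ball := (in_ball Q H).
Local Notation root_label_iso := (root_label_iso Q H).
Local Notation iso_cls := (iso_cls Q H).

Definition local_property_A : Prop :=
  forall n : nat, (1 <= n)%nat ->
  exists (ρ : Γ -> Γ -> R) (Rn : R), (0 < Rn)%R /\
    (forall x x', ceq x x' -> forall y, ρ x y = ρ x' y) /\
    (forall x y y', ceq y y' -> ρ x y = ρ x y') /\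
    (forall x, exists s, sum_nonneg (fun _ => True) ceq (fun z => (ρ x z) ^ 2)%R s
                         /\ sqrt s = 1%R) /\
    (forall x y, dist_le x y n ->
       exists s, sum_nonneg (fun _ => True) ceq (fun z => (ρ x z - ρ y z) ^ 2)%R s
                 /\ (sqrt s <= 1 / INR n)%R) /\
    (forall x z, ~ in_ball Rn x z -> ρ x z = 0%R) /\
    (forall x y θ, root_label_iso Rn x y θ ->
       forall z, in_ball Rn x z -> ρ y (θ z) = ρ x z).

(* A point of G_H^0 = lim E_n is represented by a sequence p : nat -> Γ *)
(* of vertices with x_n = [p n]_n.                                      *)
Definition unitpt (p : nat -> Γ) : Prop := forall n, iso_cls n (p (S n)) (p n).

Definition ueqv (p p' : nat -> Γ) : Prop := forall n, iso_cls n (p n) (p' n).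

(* arrows are classes of pairs (x, γ) *)
Definition arrow : Type := ((nat -> Γ) * Γ)%type.

Definition is_arrow (a : arrow) : Prop := unitpt (fst a).

Definition arr_eqv (a b : arrow) : Prop :=
  ueqv (fst a) (fst b) /\
  exists N, forall n, (N <= n)%nat ->
    ceq (mul (snd a) (fst a n)) (mul (snd b) (fst a n)).

Definition rng (a : arrow) : nat -> Γ := fst a.

Definition src (a : arrow) : nat -> Γ :=
  fun n => mul (snd a) (fst a (n + wordlen Q (snd a))%nat).

(* (x, γ')(γ'.x, γ) = (x, γγ') *)
Definition amul (a b : arrow) : arrow := (fst a, mul (snd b) (snd a)).

Definition ainv (a : arrow) : arrow := (src a, inv (snd a)).

(* Topology on G_H: generated by the sets {(x, γ) : x_N = c}, with
   N ∈ ℕ, c = [c0]_N ∈ E_N, l(γ) <= N. *)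
Definition basic (t : nat * Γ * Γ) (a : arrow) : Prop :=
  let '(N, c0, γ) := t in
  (wordlen Q γ <= N)%nat /\
  exists x, arr_eqv a (x, γ) /\ iso_cls N (x N) c0.

Definition nbhd (a : arrow) (V : arrow -> Prop) : Prop :=
  exists L : list (nat * Γ * Γ),
    (forall t, In t L -> basic t a) /\
    (forall b, is_arrow b -> (forall t, In t L -> basic t b) -> V b).

Definition arr_open (U : arrow -> Prop) : Prop :=
  forall a, is_arrow a -> U a -> nbhd a U.

Definition arr_compact (K : arrow -> Prop) : Prop :=
  forall (I : Type) (U : I -> arrow -> Prop),
    (forall i, arr_open (U i)) ->
    (forall a, is_arrow a -> K a -> exists i, U i a) ->
    exists l : list I, forall a, is_arrow a -> K a -> exists i, In i l /\ U i a.

Definition arr_respects (f : arrow -> R) : Prop :=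
  forall a b, is_arrow a -> arr_eqv a b -> f a = f b.

Definition arr_continuous (f : arrow -> R) : Prop :=
  forall a, is_arrow a -> forall eps, (0 < eps)%R ->
    nbhd a (fun b => (Rabs (f b - f a) < eps)%R).

(* f ∈ C_c(G_H) (real-valued); G_H is Hausdorff, so compact support
   = vanishing outside a compact set *)
Definition Cc (f : arrow -> R) : Prop :=
  arr_respects f /\ arr_continuous f /\
  exists K, arr_compact K /\ forall a, is_arrow a -> ~ K a -> f a = 0%R.

Definition unit_continuous (φ : (nat -> Γ) -> R) : Prop :=
  forall x, unitpt x -> forall eps, (0 < eps)%R ->
    exists N, forall y, unitpt y -> iso_cls N (y N) (x N) ->
      (Rabs (φ y - φ x) < eps)%R.

Definition fiber (x : nat -> Γ) (h : arrow) : Prop := is_arrow h /\ ueqv (rng h) x.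

(* a continuous system of probability measures m = (m^x)_{x ∈ G^0}:
   m^x is the measure on the discrete set G^x with m^x({h}) = m h *)
Definition cont_prob_system (m : arrow -> R) : Prop :=
  arr_respects m /\
  (forall a, is_arrow a -> (0 <= m a)%R) /\
  (forall x, unitpt x -> sum_nonneg (fiber x) arr_eqv m 1%R) /\
  (forall f, Cc f -> exists φ : (nat -> Γ) -> R,
       (forall x, unitpt x ->
          sum_signed (fiber x) arr_eqv (fun h => (f h * m h)%R) (φ x)) /\
       unit_continuous φ).

(* Topological amenability (Anantharaman-Delaroche–Renault): a
   topological approximate invariant mean, i.e. continuous systems of
   probability measures m with ‖g m^{s(g)} - m^{r(g)}‖_1 -> 0 uniformly on
   compact subsets of G_H; (g m^{s(g)})(h) = m^{s(g)}(g^{-1} h).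
   The net is indexed by pairs (K, ε). *)
Definition topologically_amenable : Prop :=
  forall K, arr_compact K -> forall eps, (0 < eps)%R ->
  exists m, cont_prob_system m /\
    forall g, is_arrow g -> K g ->
      exists s, sum_nonneg (fiber (rng g)) arr_eqv
                  (fun h => Rabs (m (amul (ainv g) h) - m h)) s /\ (s < eps)%R.

End Main.

(* Main.v *)
(** A ball [(B_n(p), p)] is determined up to root-label isomorphism by the elements
    of length at most [2n + 1] in the stabiliser of [p]; hence the unit space is
    compact, and eventual equality of arrows is decided at a finite level.

    If [ρ] witnesses local property A, [m^x(x, γ) = |ρ_{p_n}(γ p_n)|^2] for large
    [n] is a continuous system of probability measures, and
    [||a|^2 - |b|^2| = |a - b| |a + b|] turns [l^2]-closeness into [l^1]-closeness.

    Conversely, pairing an approximate mean [m] with the indicators of the compact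
    open bisections [{(x, γ)}] shows that [m(x, γ)] is continuous in [x]. By
    compactness there is a level [N] such that on each cylinder of level [N] the
    measures [m^x] are [l^1]-close to the image of one finitely supported
    probability measure on [Γ]. The square root of that image is local, and
    [(sqrt a - sqrt b)^2 <= |a - b|]. Restricting to the constant unit points
    [(p, p, ...)], whose fibres are the vertex set, gives local property A. *)

Require Import Defs.
From Stdlib Require Import Reals List Lia Lra Classical ClassicalEpsilon.
From Stdlib Require Import Setoid Morphisms Wf_nat.
From Stdlib Require Import FunctionalExtensionality PropExtensionality.
Import ListNotations.
Local Open Scope R_scope.

(** * Finite sums over pairwise inequivalent lists *)

Notation dec P := (excluded_middle_informative P).

Definition separated {T : Type} (eqv : T -> T -> Prop) (l : list T) : Prop :=
  ForallOrdPairs (fun a b => ~ eqv a b) l.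

Section Sums.
Context {T : Type}.
Implicit Types (f g : T -> R) (l : list T).

Lemma lsum_app f l1 l2 : lsum f (l1 ++ l2) = lsum f l1 + lsum f l2.
Proof. induction l1 as [|x l1 IH]; simpl; lra. Qed.

Lemma lsum_le f g l : (forall x, In x l -> f x <= g x) -> lsum f l <= lsum g l.
Proof.
  induction l as [|x l IH]; simpl; intros Hfg; [lra|].
  apply Rplus_le_compat; auto.
Qed.

Lemma lsum_ext f g l : (forall x, In x l -> f x = g x) -> lsum f l = lsum g l.
Proof.
  intros Hfg; apply Rle_antisym; apply lsum_le; intros x Hx; rewrite (Hfg x Hx); lra.
Qed.

Lemma lsum_plus f g l : lsum (fun x => f x + g x) l = lsum f l + lsum g l.
Proof. induction l as [|x l IH]; simpl; lra. Qed.

Lemma lsum_minus f g l : lsum (fun x => f x - g x) l = lsum f l - lsum g l.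
Proof. induction l as [|x l IH]; simpl; lra. Qed.

Lemma lsum_scal c f l : lsum (fun x => c * f x) l = c * lsum f l.
Proof. induction l as [|x l IH]; simpl; [lra|rewrite IH; lra]. Qed.

Lemma lsum_const c l : lsum (fun _ => c) l = INR (length l) * c.
Proof.
  induction l as [|x l IH]; [simpl; lra|].
  change (c + lsum (fun _ => c) l = INR (S (length l)) * c).
  rewrite IH, S_INR; lra.
Qed.

Lemma lsum_zero l : lsum (fun _ => 0) l = 0.
Proof. rewrite lsum_const; lra. Qed.

Lemma lsum_nonneg f l : (forall x, In x l -> 0 <= f x) -> 0 <= lsum f l.
Proof. intros Hf; rewrite <- (lsum_zero l); apply lsum_le; exact Hf. Qed.

Lemma lsum_Rabs f l : Rabs (lsum f l) <= lsum (fun x => Rabs (f x)) l.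
Proof.
  induction l as [|x l IH]; simpl; [rewrite Rabs_R0; lra|].
  eapply Rle_trans; [apply Rabs_triang|lra].
Qed.

End Sums.

Section SeparatedSums.
Context {T : Type}.
Implicit Types (f g : T -> R) (l : list T).

Lemma lsum_map {U : Type} (h : U -> T) f (l : list U) :
  lsum f (map h l) = lsum (fun x => f (h x)) l.
Proof. induction l as [|x l IH]; simpl; [|rewrite IH]; reflexivity. Qed.

Lemma lsum_swap {U : Type} (F : T -> U -> R) l (l' : list U) :
  lsum (fun x => lsum (F x) l') l = lsum (fun y => lsum (fun x => F x y) l) l'.
Proof.
  induction l as [|x l IH]; simpl; [now rewrite lsum_zero|].
  now rewrite IH, lsum_plus.
Qed.

Lemma lsum_if (P : T -> Prop) f l :
  exists l', (forall x, In x l' <-> In x l /\ P x) /\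
    lsum (fun x => if dec (P x) then f x else 0) l = lsum f l' /\
    (forall eqv, separated eqv l -> separated eqv l').
Proof.
  exists (filter (fun x => if dec (P x) then true else false) l); split; [|split].
  - intros x; rewrite filter_In; destruct (dec (P x)); intuition congruence.
  - induction l as [|x l IH]; simpl; [reflexivity|].
    destruct (dec (P x)); simpl; lra.
  - intros eqv Hl; induction Hl as [|x l Hx Hl IH]; simpl; [constructor|].
    destruct (dec (P x)); [|exact IH].
    constructor; [|exact IH].
    rewrite Forall_forall in *; intros y Hy; apply filter_In in Hy; apply Hx; tauto.
Qed.

Variable eqv : T -> T -> Prop.

Lemma separated_cons x l :
  separated eqv (x :: l) <-> (forall y, In y l -> ~ eqv x y) /\ separated eqv l.
Proof.
  split.
  - intros Hs; inversion Hs as [|? ? Hx Hl]; subst; split; [|exact Hl].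
    now apply Forall_forall.
  - intros [Hx Hl]; constructor; [now apply Forall_forall|exact Hl].
Qed.

Lemma separated_app l1 l2 :
  separated eqv l1 -> separated eqv l2 ->
  (forall x y, In x l1 -> In y l2 -> ~ eqv x y) -> separated eqv (l1 ++ l2).
Proof.
  intros H1 H2; induction l1 as [|x l1 IH]; simpl; intros H12; [exact H2|].
  apply separated_cons in H1 as [Hx H1]; apply separated_cons; split.
  - intros y Hy; apply in_app_or in Hy as [Hy|Hy]; auto.
  - apply IH; auto.
Qed.

Lemma separated_map {U : Type} (eqv' : U -> U -> Prop) (h : T -> U) l :
  (forall x y, In x l -> In y l -> eqv' (h x) (h y) -> eqv x y) ->
  separated eqv l -> separated eqv' (map h l).
Proof.
  induction l as [|x l IH]; intros Hh Hs; simpl; [constructor|].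
  apply separated_cons in Hs as [Hx Hs]; constructor.
  - rewrite Forall_forall; intros y Hy; apply in_map_iff in Hy as [z [<- Hz]].
    intros Hxz; apply (Hx z Hz), Hh; simpl; auto.
  - apply IH; [|exact Hs]; simpl in Hh; auto.
Qed.

Lemma lsum_indicator_none (P : T -> Prop) f l :
  (forall x, In x l -> ~ P x) -> lsum (fun x => if dec (P x) then f x else 0) l = 0.
Proof.
  intros Hn; transitivity (lsum (fun _ => 0) l); [|apply lsum_zero].
  apply lsum_ext; intros z Hz.
  destruct (dec (P z)); [exfalso; eapply Hn; eauto|reflexivity].
Qed.

(** [P] lies within one class and [l] meets each class at most once, so only [a] contributes. *)
Lemma lsum_indicator_one (P : T -> Prop) f l a :
  separated eqv l -> (forall x y, P x -> P y -> eqv x y) -> In a l -> P a ->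
  lsum (fun x => if dec (P x) then f x else 0) l = f a.
Proof.
  intros Hs HP Ha Pa; induction l as [|x l IH]; [destruct Ha|].
  apply separated_cons in Hs as [Hx Hs]; simpl.
  destruct Ha as [->|Ha].
  - destruct (dec (P a)) as [_|]; [|contradiction].
    rewrite lsum_indicator_none; [lra|].
    intros y Hy Py; apply (Hx y Hy); auto.
  - rewrite (IH Hs Ha); destruct (dec (P x)) as [Px|]; [|lra].
    exfalso; apply (Hx a Ha); auto.
Qed.

Context {eqv_equiv : Equivalence eqv}.

Lemma separated_reps l :
  exists l', incl l' l /\ separated eqv l' /\
    forall x, In x l -> exists y, In y l' /\ eqv x y.
Proof.
  induction l as [|x l [l' [Hi [Hs Hr]]]].
  - exists []; repeat split; [intros y []|constructor|intros y []].
  - destruct (classic (exists y, In y l' /\ eqv x y)) as [Hx|Hx].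
    + exists l'; repeat split; [intros y Hy; right; auto|exact Hs|].
      intros y [<-|Hy]; auto.
    + exists (x :: l'); repeat split.
      * intros y [<-|Hy]; [left|right]; auto.
      * apply separated_cons; split; [|exact Hs]; intros y Hy Hxy; apply Hx; eauto.
      * intros y [<-|Hy]; [exists x; split; [left; auto|reflexivity]|].
        destruct (Hr y Hy) as [z [Hz Hyz]]; exists z; split; [right|]; auto.
Qed.

(** Each nonzero term over [l'] is cancelled against its match in [l]. Two elements of [l'] cannot
    share a match, since they would be equivalent; what remains of [l] is nonnegative. *)
Lemma lsum_separated_le f l l' :
  separated eqv l' ->
  (forall y, In y l -> 0 <= f y) ->
  (forall x, In x l' -> f x <> 0 -> exists y, In y l /\ eqv x y /\ f x = f y) ->
  lsum f l' <= lsum f l.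
Proof.
  revert l; induction l' as [|x l' IH]; intros l Hs Hf Hm; simpl.
  - apply lsum_nonneg; auto.
  - apply separated_cons in Hs as [Hx Hs].
    destruct (Req_dec (f x) 0) as [H0|H0].
    { rewrite H0, Rplus_0_l; apply IH; simpl in Hm; auto. }
    destruct (Hm x (or_introl eq_refl) H0) as [y [Hy [Hxy Efy]]].
    apply in_split in Hy as [l1 [l2 ->]].
    rewrite lsum_app; simpl.
    enough (lsum f l' <= lsum f (l1 ++ l2)) by (rewrite lsum_app in *; lra).
    apply IH; [exact Hs| |].
    + intros z Hz; apply Hf; apply in_app_iff in Hz; apply in_app_iff; simpl; tauto.
    + intros z Hz Hz0.
      destruct (Hm z (or_intror Hz) Hz0) as [t [Ht [Hzt Eft]]].
      exists t; split; [|auto].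
      apply in_app_iff in Ht; simpl in Ht; apply in_app_iff.
      destruct Ht as [Ht|[<-|Ht]]; [tauto| |tauto].
      exfalso; apply (Hx z Hz); now rewrite Hxy, Hzt.
Qed.

(** * Infinite sums *)

Lemma sum_nonneg_unique (A : T -> Prop) f s s' :
  sum_nonneg A eqv f s -> sum_nonneg A eqv f s' -> s = s'.
Proof. apply is_lub_u. Qed.

Lemma lsum_le_sum_nonneg (A : T -> Prop) f s l :
  sum_nonneg A eqv f s -> (forall x, In x l -> A x) -> separated eqv l -> lsum f l <= s.
Proof.
  intros [Hub _] HA Hl; apply Hub; exists l; split; [now apply Forall_forall|auto].
Qed.

Lemma sum_nonneg_approx (A : T -> Prop) f s eps :
  sum_nonneg A eqv f s -> 0 < eps ->
  exists l, (forall x, In x l -> A x) /\ separated eqv l /\ s - eps < lsum f l.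
Proof.
  intros [_ Hlub] Heps; apply NNPP; intros Hn.
  enough (s <= s - eps) by lra.
  apply Hlub; intros r [l [HA [Hl ->]]].
  destruct (Rle_or_lt (lsum f l) (s - eps)) as [|Hlt]; [assumption|].
  exfalso; apply Hn; exists l; rewrite Forall_forall in HA; auto.
Qed.

Lemma sum_nonneg_bounded (A : T -> Prop) f b :
  (forall l, (forall x, In x l -> A x) -> separated eqv l -> lsum f l <= b) ->
  exists s, sum_nonneg A eqv f s /\ s <= b.
Proof.
  intros Hb.
  destruct (completeness (fun r => exists l, Forall A l /\
    ForallOrdPairs (fun a b => ~ eqv a b) l /\ r = lsum f l)) as [s Hs].
  - exists b; intros r [l [HA [Hl ->]]]; rewrite Forall_forall in HA; auto.
  - exists 0, []; repeat split; constructor.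
  - exists s; split; [exact Hs|].
    apply Hs; intros r [l [HA [Hl ->]]]; rewrite Forall_forall in HA; auto.
Qed.

(** Evaluates the supremum when only finitely many classes carry mass: [l] has one representative of
    each, so no separated list can do better. *)
Lemma sum_nonneg_reps (A : T -> Prop) f l :
  (forall x, In x l -> A x) -> separated eqv l ->
  (forall x, In x l -> 0 <= f x) ->
  (forall x, A x -> f x <> 0 -> exists y, In y l /\ eqv x y /\ f x = f y) ->
  sum_nonneg A eqv f (lsum f l).
Proof.
  intros HA Hl Hf Hr; split.
  - intros r [l' [HA' [Hl' ->]]]; rewrite Forall_forall in HA'.
    apply lsum_separated_le; auto.
  - intros b Hb; apply Hb; exists l; rewrite Forall_forall; auto.
Qed.

Lemma sum_signed_unique (A : T -> Prop) f s s' :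
  sum_signed A eqv f s -> sum_signed A eqv f s' -> s = s'.
Proof.
  intros [a [b [Ha [Hb ->]]]] [a' [b' [Ha' [Hb' ->]]]].
  now rewrite (sum_nonneg_unique _ _ _ _ Ha Ha'), (sum_nonneg_unique _ _ _ _ Hb Hb').
Qed.

Lemma sum_signed_reps (A : T -> Prop) f l :
  (forall x, In x l -> A x) -> separated eqv l ->
  (forall x, A x -> f x <> 0 -> exists y, In y l /\ eqv x y /\ f x = f y) ->
  sum_signed A eqv f (lsum f l).
Proof.
  intros HA Hl Hr.
  assert (Hpart : forall h : R -> R, h 0 = 0 -> (forall r, 0 <= h r) ->
    sum_nonneg A eqv (fun x => h (f x)) (lsum (fun x => h (f x)) l)).
  { intros h h0 hpos; apply sum_nonneg_reps; auto.
    intros x Hx Hhx; destruct (Hr x Hx) as [y [Hy [Hxy E]]].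
    - intros E; apply Hhx; now rewrite E.
    - exists y; rewrite E; auto. }
  exists (lsum (fun x => Rmax (f x) 0) l), (lsum (fun x => Rmax (- f x) 0) l).
  split; [|split].
  - apply (Hpart (fun r => Rmax r 0)); [apply Rmax_left; lra|intros; apply Rmax_r].
  - apply (Hpart (fun r => Rmax (- r) 0)); [rewrite Ropp_0; apply Rmax_left; lra|intros; apply Rmax_r].
  - rewrite <- lsum_minus; apply lsum_ext; intros x _.
    unfold Rmax; destruct (Rle_dec (f x) 0), (Rle_dec (- f x) 0); lra.
Qed.

End SeparatedSums.

(** * Finitely supported measures *)

Section FiniteMeasures.
Context {T : Type} (eqv : T -> T -> Prop) {eqv_equiv : Equivalence eqv}.

(** Density on the quotient by [eqv] of the weighted sum of Dirac masses listed in [l]; weights of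
    equivalent atoms add up. *)
Definition pmass (l : list (T * R)) (z : T) : R :=
  lsum (fun av => if dec (eqv (fst av) z) then snd av else 0) l.

Lemma pmass_nonneg (l : list (T * R)) z : (forall av, In av l -> 0 <= snd av) -> 0 <= pmass l z.
Proof.
  intros Hl; apply lsum_nonneg; intros av Hav.
  destruct (dec _); [auto|lra].
Qed.

Lemma lsum_atom_le a v lz :
  separated eqv lz -> 0 <= v -> lsum (fun z => if dec (eqv a z) then v else 0) lz <= v.
Proof.
  intros Hz Hv; destruct (classic (exists z, In z lz /\ eqv a z)) as [[z [Hin Haz]]|Hn].
  - rewrite (lsum_indicator_one eqv (eqv a) (fun _ => v) lz z); auto; [lra|].
    intros x y Hx Hy; now rewrite <- Hx.
  - rewrite (lsum_indicator_none (eqv a) (fun _ => v)); eauto.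
Qed.

Lemma lsum_pmass_le (l : list (T * R)) lz :
  separated eqv lz -> (forall av, In av l -> 0 <= snd av) ->
  lsum (pmass l) lz <= lsum snd l.
Proof.
  intros Hz Hl; unfold pmass; rewrite lsum_swap; apply lsum_le; intros av Hav.
  apply lsum_atom_le; auto.
Qed.

Lemma sum_pmass (l : list (T * R)) :
  (forall av, In av l -> 0 <= snd av) ->
  sum_nonneg (fun _ => True) eqv (pmass l) (lsum snd l).
Proof.
  intros Hl; split.
  - intros r [lz [_ [Hz ->]]]; now apply lsum_pmass_le.
  - intros b Hb.
    (* Over representatives of the atoms every weight is counted exactly once, so the bound is
       attained. *)
    destruct (separated_reps eqv (map fst l)) as [lz [_ [Hz Hr]]].
    eapply Rle_trans; [|apply Hb; exists lz; repeat split; [now apply Forall_forall|exact Hz]].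
    unfold pmass; rewrite lsum_swap; apply lsum_le; intros av Hav.
    destruct (Hr (fst av) (in_map fst l av Hav)) as [z [Hin Haz]].
    rewrite (lsum_indicator_one eqv (eqv (fst av)) (fun _ => snd av) lz z); auto; [lra|].
    intros x y Hx Hy; now rewrite <- Hx.
Qed.

(** At the atoms the error is the difference of weights. Off the atoms it is [m] itself, whose mass
    there is at most 1 minus its mass on the atoms: the atoms together with the missed points of
    [lz] form one separated list. *)
Lemma pmass_approx (m : T -> R) (l : list (T * R)) lz :
  (forall z, 0 <= m z) -> (forall z z', eqv z z' -> m z = m z') ->
  (forall l0, separated eqv l0 -> lsum m l0 <= 1) ->
  separated eqv (map fst l) -> separated eqv lz ->
  lsum (fun z => Rabs (m z - pmass l z)) lz <=
  lsum (fun av => Rabs (m (fst av) - snd av)) l + (1 - lsum (fun av => m (fst av)) l).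
Proof.
  intros m0 mE m1 Hl Hz.
  set (l' := map (fun av => (fst av, Rabs (m (fst av) - snd av))) l).
  set (miss := fun z => forall av, In av l -> ~ eqv (fst av) z).
  assert (Hl2 : separated (fun av bv => eqv (fst av) (fst bv)) l).
  { clear - Hl; induction l as [|av l IH]; simpl in *; [constructor|].
    apply separated_cons in Hl as [Ha Hl]; constructor; [|apply IH, Hl].
    rewrite Forall_forall; intros bv Hbv; apply Ha, in_map, Hbv. }
  apply Rle_trans with
    (lsum (fun z => pmass l' z + (if dec (miss z) then m z else 0)) lz).
  - apply lsum_le; intros z _; unfold pmass, l'; rewrite lsum_map; simpl.
    destruct (dec (miss z)) as [Hm|Hm].
    + rewrite !lsum_indicator_none by exact Hm; rewrite Rminus_0_r, Rabs_pos_eq; auto; lra.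
    + apply not_all_ex_not in Hm as [av Hm]; apply imply_to_and in Hm as [Hav Haz].
      apply NNPP in Haz.
      assert (HP : forall x y : T * R, eqv (fst x) z -> eqv (fst y) z -> eqv (fst x) (fst y)).
      { intros x y Hx Hy; now rewrite Hx, Hy. }
      rewrite (lsum_indicator_one _ (fun av => eqv (fst av) z) snd l av Hl2 HP Hav Haz).
      rewrite (lsum_indicator_one _ (fun av => eqv (fst av) z)
        (fun av => Rabs (m (fst av) - snd av)) l av Hl2 HP Hav Haz).
      rewrite (mE _ _ Haz); lra.
  - rewrite lsum_plus; apply Rplus_le_compat.
    + eapply Rle_trans; [apply lsum_pmass_le; [exact Hz|]|].
      * intros av Hav; apply in_map_iff in Hav as [bv [<- _]]; apply Rabs_pos.
      * unfold l'; rewrite lsum_map; simpl; lra.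
    + destruct (lsum_if miss m lz) as [l1 [Hin [-> Hs]]].
      enough (lsum m (map fst l ++ l1) <= 1) by (rewrite lsum_app, lsum_map in *; lra).
      apply m1, separated_app; auto.
      intros x y Hx Hy Hxy; apply in_map_iff in Hx as [av [<- Hav]].
      apply Hin in Hy as [_ Hy]; apply (Hy av Hav Hxy).
Qed.

End FiniteMeasures.
(** * Words and Schreier graphs *)

Section Groups.
Context {G : grp}.
Implicit Types x y : G.

Lemma mulKg x y : mul (inv x) (mul x y) = y.
Proof. now rewrite mulA, mulVg, mul1g. Qed.

Lemma mulKVg x y : mul x (mul (inv x) y) = y.
Proof. now rewrite mulA, mulgV, mul1g. Qed.

Lemma inv_unique x y : mul x y = one -> inv x = y.
Proof. intros E; now rewrite <- (mulKg x y), E, mulg1. Qed.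

Lemma inv_mul x y : inv (mul x y) = mul (inv y) (inv x).
Proof. apply inv_unique; now rewrite <- mulA, (mulA y), mulgV, mul1g, mulgV. Qed.

Lemma inv_inv x : inv (inv x) = x.
Proof. apply inv_unique, mulVg. Qed.

Lemma inv_one : inv (@one G) = one.
Proof. apply inv_unique, mul1g. Qed.

Lemma prod_word_app (w w' : list G) :
  prod_word (w ++ w') = mul (prod_word w) (prod_word w').
Proof.
  induction w as [|q w IH]; simpl; [now rewrite mul1g|].
  fold (prod_word (w ++ w')); rewrite IH; apply mulA.
Qed.

End Groups.

#[local] Hint Rewrite <- @mulA : grp.
#[local] Hint Rewrite @mul1g @mulg1 @mulVg @mulgV @mulKg @mulKVg @inv_mul @inv_inv @inv_one : grp.

Ltac gsimp := autorewrite with grp.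

Section Schreier.
Context {G : grp} (Q : list G) (H : G -> Prop).
Hypothesis HQ : finite_symmetric_generating Q.
Hypothesis HH : subgroup H.

Lemma ceq_equiv : Equivalence (ceq H).
Proof.
  destruct HH as [H1 [HM HV]]; unfold ceq; split.
  - intros u; now gsimp.
  - intros u v Huv; apply HV in Huv; now rewrite inv_mul, inv_inv in Huv.
  - intros u v w Huv Hvw; generalize (HM _ _ Huv Hvw); now gsimp.
Qed.
#[local] Existing Instance ceq_equiv.

Lemma ceq_mul g u v : ceq H (mul g u) (mul g v) <-> ceq H u v.
Proof. unfold ceq; now gsimp. Qed.

#[local] Instance mul_ceq : Proper (eq ==> ceq H ==> ceq H) mul.
Proof. intros g _ <- u v Huv; now apply ceq_mul. Qed.

(** An upper bound on length that avoids the choice in [wordlen]; such bounds add under products. *)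
Definition wle (g : G) (k : nat) : Prop :=
  exists w, word_in Q w /\ (length w <= k)%nat /\ prod_word w = g.

Lemma wle_mono g k k' : (k <= k')%nat -> wle g k -> wle g k'.
Proof. intros Hk [w [Hw [Hl E]]]; exists w; repeat split; auto; lia. Qed.

Lemma wle_one : wle one 0.
Proof. exists []; repeat split; constructor. Qed.

Lemma wle_mul g g' k k' : wle g k -> wle g' k' -> wle (mul g g') (k + k').
Proof.
  intros [w [Hw [Hl <-]]] [w' [Hw' [Hl' <-]]]; exists (w ++ w'); repeat split.
  - now apply Forall_app.
  - rewrite length_app; lia.
  - apply prod_word_app.
Qed.

Lemma wle_gen q : In q Q -> wle q 1.
Proof.
  intros Hq; exists [q]; repeat split; [repeat constructor; exact Hq|simpl; lia|].
  apply mulg1.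
Qed.

Lemma wle_inv g k : wle g k -> wle (inv g) k.
Proof.
  intros [w [Hw [Hl <-]]]; revert k Hl; induction Hw as [|q w Hq Hw IH]; intros k Hl.
  - simpl; rewrite inv_one; apply (wle_mono _ 0); [lia|apply wle_one].
  - simpl in *; rewrite inv_mul; apply (wle_mono _ (length w + 1)); [lia|].
    apply wle_mul; [apply IH; lia|apply wle_gen, HQ, Hq].
Qed.

Lemma wordlen_spec g : is_wordlen Q g (wordlen Q g).
Proof.
  unfold wordlen; apply epsilon_spec.
  destruct (proj2 HQ g) as [w0 [Hw0 E0]].
  destruct (dec_inh_nat_subset_has_unique_least_element
    (fun k => exists w, word_in Q w /\ length w = k /\ prod_word w = g)) as [k [[Hk Hmin] _]].
  - intros n; apply classic.
  - exists (length w0), w0; auto.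
  - exists k; split; [exact Hk|]; intros w Hw E; apply Hmin; exists w; auto.
Qed.

Lemma wle_wordlen g : wle g (wordlen Q g).
Proof.
  destruct (wordlen_spec g) as [[w [Hw [Hl E]]] _]; exists w; rewrite Hl; auto.
Qed.

Lemma wordlen_le g k : wle g k -> (wordlen Q g <= k)%nat.
Proof.
  intros [w [Hw [Hl E]]]; destruct (wordlen_spec g) as [_ Hmin].
  specialize (Hmin w Hw E); lia.
Qed.

(** The ball of radius [k] in the group as a list, the source of all finiteness below. *)
Fixpoint words (k : nat) : list G :=
  match k with
  | 0%nat => [one]
  | S k => words k ++ flat_map (fun q => map (mul q) (words k)) Q
  end.

Lemma words_spec g k : wle g k <-> In g (words k).
Proof.
  split.
  - intros [w [Hw [Hl <-]]]; revert k Hl; induction Hw as [|q w Hq Hw IH]; intros k Hl.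
    + clear Hl; induction k; simpl; [auto|apply in_or_app; auto].
    + destruct k as [|k]; simpl in *; [lia|].
      apply in_or_app; right; apply in_flat_map; exists q; split; [exact Hq|].
      apply in_map, IH; lia.
  - revert g; induction k as [|k IH]; simpl; intros g Hg.
    + destruct Hg as [<-|[]]; apply wle_one.
    + apply in_app_or in Hg as [Hg|Hg]; [apply (wle_mono _ k); auto|].
      apply in_flat_map in Hg as [q [Hq Hg]]; apply in_map_iff in Hg as [h [<- Hh]].
      apply (wle_mul _ _ 1 k); [now apply wle_gen|auto].
Qed.

(** [agree k u v]: the stabilisers of the vertices [uH] and [vH] contain the
    same elements of length at most [k]. *)
Definition agree (k : nat) (u v : G) : Prop :=
  forall g, wle g k -> (ceq H (mul g u) u <-> ceq H (mul g v) v).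

#[local] Instance agree_equiv k : Equivalence (agree k).
Proof.
  split.
  - intros u g _; reflexivity.
  - intros u v Huv g Hg; symmetry; auto.
  - intros u v w Huv Hvw g Hg; rewrite (Huv g Hg); auto.
Qed.

Lemma agree_mono k k' u v : (k <= k')%nat -> agree k' u v -> agree k u v.
Proof. intros Hk Huv g Hg; apply Huv, (wle_mono _ k); auto. Qed.

Lemma ceq_agree k u v : ceq H u v -> agree k u v.
Proof. intros Huv g _; now rewrite Huv. Qed.

(** The equation [a u = b u] of vertices says that [inv b] times [a], of length at most [i + j],
    stabilises [u]. *)
Lemma agree_vertices k u v a b i j :
  agree k u v -> wle a i -> wle b j -> (i + j <= k)%nat ->
  (ceq H (mul a u) (mul b u) <-> ceq H (mul a v) (mul b v)).
Proof.
  intros Huv Ha Hb Hk.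
  assert (E : forall t, ceq H (mul a t) (mul b t) <-> ceq H (mul (mul (inv b) a) t) t).
  { intros t; rewrite <- (ceq_mul (inv b) (mul a t) (mul b t)); now gsimp. }
  rewrite !E; apply Huv, (wle_mono _ (j + i)); [lia|].
  apply wle_mul; [apply wle_inv|]; assumption.
Qed.

(** The stabiliser of [g u] is the conjugate by [g] of that of [u], and conjugation costs [2 * j]
    letters. *)
Lemma agree_mul k u v g j :
  wle g j -> agree (k + 2 * j) u v -> agree k (mul g u) (mul g v).
Proof.
  intros Hg Huv h Hh; rewrite !mulA.
  apply (agree_vertices (k + 2 * j) _ _ _ _ (k + j) j); auto; [|lia].
  now apply wle_mul.
Qed.

Lemma in_ball_iff r u a :
  in_ball Q H r u a <-> exists g k, INR k <= r /\ wle g k /\ ceq H (mul g u) a.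
Proof.
  split.
  - intros [k [Hk [w [Hw [Hl Hc]]]]]; exists (prod_word w), k; repeat split; auto.
    exists w; auto.
  - intros [g [k [Hk [[w [Hw [Hl <-]]] Hc]]]]; exists k; split; [auto|exists w; auto].
Qed.

(** Follow the path from [u] spelled by [w], read from its last letter: it stays in the ball, and θ
    preserves each labelled edge on it. *)
Lemma root_label_iso_word n u v θ w :
  root_label_iso Q H (INR n) u v θ -> word_in Q w -> (length w <= n)%nat ->
  ceq H (θ (mul (prod_word w) u)) (mul (prod_word w) v).
Proof.
  intros [Hwd [_ [Hroot [_ [_ Hedge]]]]] Hw; induction Hw as [|q w Hq Hw IH]; intros Hl.
  - simpl; rewrite !mul1g; exact Hroot.
  - simpl in *; fold (prod_word w) in *.
    assert (Hball : forall w', word_in Q w' -> (length w' <= n)%nat ->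
      in_ball Q H (INR n) u (mul (prod_word w') u)).
    { intros w' Hw' Hl'; exists n; split; [lra|]; exists w'; repeat split; auto; reflexivity. }
    rewrite <- !mulA, <- IH by lia; symmetry.
    apply (proj1 (Hedge (mul (prod_word w) u) (mul q (mul (prod_word w) u)) q
      (Hball w Hw ltac:(lia)) ltac:(rewrite mulA; apply (Hball (q :: w)); auto; now constructor) Hq)).
    reflexivity.
Qed.

(** A word of length [2n + 1] fixing [u] splits into two paths from [u] of lengths
    [n] and [n + 1] with the same end; the last edge of the longer one joins two
    points of the [n]-ball. *)
Lemma root_label_iso_agree n u v θ :
  root_label_iso Q H (INR n) u v θ -> agree (2 * n + 1) u v.
Proof.
  intros Hθ g [w [Hw [Hl <-]]].
  pose proof (root_label_iso_word n u v θ) as Hword.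
  destruct Hθ as [Hwd [Hmap [Hroot [Hinj [Hsurj Hedge]]]]].
  specialize (fun w => Hword w (conj Hwd (conj Hmap (conj Hroot (conj Hinj (conj Hsurj Hedge)))))).
  assert (Hball : forall w', word_in Q w' -> (length w' <= n)%nat ->
    in_ball Q H (INR n) u (mul (prod_word w') u)).
  { intros w' Hw' Hl'; exists n; split; [lra|]; exists w'; repeat split; auto; reflexivity. }
  set (w1 := firstn n w); set (w2 := skipn n w).
  assert (Ew : w = w1 ++ w2) by (symmetry; apply firstn_skipn).
  assert (Hw12 : word_in Q w1 /\ word_in Q w2) by (rewrite Ew in Hw; now apply Forall_app).
  assert (Hl1 : (length w1 <= n)%nat) by apply firstn_le_length.
  assert (Hl2 : (length w2 <= n + 1)%nat) by (unfold w2; rewrite length_skipn; lia).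
  destruct Hw12 as [Hw1 Hw2].
  destruct (wle_inv (prod_word w1) n) as [w1' [Hw1' [Hl1' Ew1']]].
  { exists w1; auto. }
  assert (E : forall t, ceq H (mul (prod_word w) t) t <->
    ceq H (mul (prod_word w2) t) (mul (prod_word w1') t)).
  { intros t; rewrite Ew, prod_word_app, Ew1'.
    rewrite <- (ceq_mul (inv (prod_word w1))); now gsimp. }
  rewrite !E; clearbody w2; destruct Hw2 as [|q w2 Hq Hw2]; simpl in *; rewrite ?mul1g.
  - rewrite <- (Hword w1' Hw1' Hl1').
    assert (Hu : in_ball Q H (INR n) u u).
    { exists 0%nat; split; [apply pos_INR|]; exists []; split; [apply Forall_nil|split; [simpl; lia|]].
      simpl; rewrite mul1g; reflexivity. }
    split; intros Hc.
    + rewrite <- Hroot; now apply Hwd.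
    + rewrite <- Hroot in Hc; apply Hinj in Hc; auto.
  - rewrite <- !mulA.
    rewrite <- (Hword w1' Hw1' Hl1'), <- (Hword w2 Hw2) by lia.
    apply Hedge; auto; apply Hball; auto; lia.
Qed.

(** The isomorphism sends [g u] to [g v] for [g] of length at most [n]; [agree] makes this well
    defined and injective. The radius is real because local property A uses real radii. *)
Lemma agree_root_label_iso n r u v :
  agree (2 * n + 1) u v -> r <= INR n ->
  exists θ, root_label_iso Q H r u v θ /\
    forall g, wle g n -> ceq H (θ (mul g u)) (mul g v).
Proof.
  intros Huv Hr.
  (* Any short [g] reaching [a] may be chosen; outside the ball the value is arbitrary and never
     matters. *)
  set (θ := fun a => mul (epsilon (inhabits one) (fun g => wle g n /\ ceq H (mul g u) a)) v).
  assert (Hθ : forall g a, wle g n -> ceq H (mul g u) a -> ceq H (θ a) (mul g v)).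
  { intros g a Hg Hga; unfold θ.
    destruct (epsilon_spec (inhabits one) (fun g => wle g n /\ ceq H (mul g u) a))
      as [Hh Hha]; [eauto|].
    apply (agree_vertices _ _ _ _ _ n n Huv); auto; [lia|]; now rewrite Hga. }
  assert (Hb : forall t a, in_ball Q H r t a ->
    exists g, wle g n /\ ceq H (mul g t) a /\ forall t', in_ball Q H r t' (mul g t')).
  { intros t a Ha; apply in_ball_iff in Ha as [g [k [Hk [Hg Hga]]]].
    exists g; repeat split; auto.
    - apply (wle_mono _ k); [|exact Hg]; apply INR_le; lra.
    - intros t'; apply in_ball_iff; exists g, k; repeat split; auto; reflexivity. }
  assert (Hbe : forall t a b, ceq H a b -> in_ball Q H r t a -> in_ball Q H r t b).
  { intros t a b Hab Ha; apply in_ball_iff in Ha as [g [k [Hk [Hg Hga]]]].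
    apply in_ball_iff; exists g, k; repeat split; auto; now rewrite Hga. }
  exists θ; split; [repeat split|].
  - intros a b Ha Hab; destruct (Hb _ _ Ha) as [g [Hg [Hga _]]].
    rewrite (Hθ g a), (Hθ g b); auto; [reflexivity|now rewrite Hga].
  - intros a Ha; destruct (Hb _ _ Ha) as [g [Hg [Hga Hg']]].
    apply (Hbe _ (mul g v)); [symmetry; auto|auto].
  - rewrite (Hθ one u), mul1g; [reflexivity| |rewrite mul1g; reflexivity].
    apply (wle_mono _ 0); [lia|apply wle_one].
  - intros a b Ha Hb'; destruct (Hb _ _ Ha) as [g [Hg [Hga _]]].
    destruct (Hb _ _ Hb') as [h [Hh [Hhb _]]].
    rewrite (Hθ g a), (Hθ h b), <- Hga, <- Hhb by auto.
    apply (agree_vertices _ _ _ _ _ n n Huv); auto; lia.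
  - intros b Hb'; destruct (Hb _ _ Hb') as [g [Hg [Hgb Hg']]].
    exists (mul g u); split; [auto|]; rewrite (Hθ g (mul g u)); auto; reflexivity.
  (* An edge compares a path of length [1 + n] with one of length [n], which exhausts the budget
     [2 * n + 1]. *)
  - destruct (Hb _ _ H0) as [g [Hg [Hga _]]], (Hb _ _ H1) as [h [Hh [Hhb _]]].
    rewrite (Hθ g a), (Hθ h b), <- Hga, <- Hhb, !mulA by auto.
    apply (agree_vertices _ _ _ _ _ (1 + n) n Huv); auto; [|lia].
    apply wle_mul; [now apply wle_gen|auto].
  - destruct (Hb _ _ H0) as [g [Hg [Hga _]]], (Hb _ _ H1) as [h [Hh [Hhb _]]].
    rewrite (Hθ g a), (Hθ h b), <- Hga, <- Hhb, !mulA by auto.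
    apply (agree_vertices _ _ _ _ _ (1 + n) n Huv); auto; [|lia].
    apply wle_mul; [now apply wle_gen|auto].
  - intros g Hg; apply Hθ; auto; reflexivity.
Qed.

Lemma iso_cls_agree n u v : iso_cls Q H n u v <-> agree (2 * n + 1) u v.
Proof.
  split.
  - intros [θ Hθ]; exact (root_label_iso_agree n u v θ Hθ).
  - intros Huv; destruct (agree_root_label_iso n (INR n) u v Huv) as [θ [Hθ _]]; [lra|].
    exists θ; exact Hθ.
Qed.

(** Each new predicate splits a type into at most two. If one half is empty, [pick] returns a
    harmless extra representative. *)
Lemma finitely_many_types {X : Type} (x0 : X) (Ps : list (X -> Prop)) :
  exists reps, forall x, exists y, In y reps /\ forall P, In P Ps -> (P x <-> P y).
Proof.
  induction Ps as [|P Ps [reps Hr]].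
  - exists [x0]; intros x; exists x0; split; [left; reflexivity|intros P []].
  - set (pick := fun y b => epsilon (inhabits x0)
      (fun x => (forall P, In P Ps -> (P x <-> P y)) /\ (P x <-> b = true))).
    exists (flat_map (fun y => [pick y true; pick y false]) reps); intros x.
    destruct (Hr x) as [y [Hy Hxy]].
    assert (Hb : exists b, P x <-> b = true).
    { destruct (classic (P x)); [exists true|exists false]; intuition discriminate. }
    destruct Hb as [b Hb]; exists (pick y b); split.
    + apply in_flat_map; exists y; split; [exact Hy|]; destruct b; simpl; auto.
    + destruct (epsilon_spec (inhabits x0)
        (fun x => (forall P, In P Ps -> (P x <-> P y)) /\ (P x <-> b = true))) as [H1 H2].
      { exists x; auto. }
      fold (pick y b) in H1, H2.
      intros P' [<-|HP']; [now rewrite H2|now rewrite H1, Hxy].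
Qed.

Lemma agree_finite k : exists reps, forall u, exists v, In v reps /\ agree k u v.
Proof.
  destruct (finitely_many_types (one : G)
    (map (fun g u => ceq H (mul g u) u) (words k))) as [reps Hr].
  exists reps; intros u; destruct (Hr u) as [v [Hv Huv]]; exists v; split; [exact Hv|].
  intros g Hg; apply (Huv (fun u => ceq H (mul g u) u)).
  apply (in_map (fun g u => ceq H (mul g u) u)); now apply words_spec.
Qed.
(** * The unit space *)

#[local] Instance iso_equiv n : Equivalence (iso_cls Q H n).
Proof.
  split.
  - intros u; now apply iso_cls_agree.
  - intros u v; rewrite !iso_cls_agree; now symmetry.
  - intros u v w; rewrite !iso_cls_agree; now transitivity v.
Qed.

Lemma iso_mono n m u v : (n <= m)%nat -> iso_cls Q H m u v -> iso_cls Q H n u v.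
Proof. rewrite !iso_cls_agree; intros Hn; apply agree_mono; lia. Qed.

Lemma iso_vertices n u v a b i j :
  iso_cls Q H n u v -> wle a i -> wle b j -> (i + j <= 2 * n + 1)%nat ->
  (ceq H (mul a u) (mul b u) <-> ceq H (mul a v) (mul b v)).
Proof. rewrite iso_cls_agree; intros Huv; now apply agree_vertices. Qed.

Lemma ceq_iso n u v : ceq H u v -> iso_cls Q H n u v.
Proof. rewrite iso_cls_agree; apply ceq_agree. Qed.

Lemma iso_finite n : exists reps, forall u, exists v, In v reps /\ iso_cls Q H n u v.
Proof.
  destruct (agree_finite (2 * n + 1)) as [reps Hr]; exists reps; intros u.
  destruct (Hr u) as [v [Hv Huv]]; exists v; now rewrite iso_cls_agree.
Qed.

Lemma unit_iso x n m : unitpt Q H x -> (n <= m)%nat -> iso_cls Q H n (x m) (x n).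
Proof.
  intros Hx Hn; induction Hn as [|m Hn IH]; [reflexivity|].
  transitivity (x m); [|exact IH]; apply (iso_mono n m); auto.
Qed.

Lemma unit_iso_mono x y n m :
  unitpt Q H x -> unitpt Q H y -> (n <= m)%nat ->
  iso_cls Q H m (y m) (x m) -> iso_cls Q H n (y n) (x n).
Proof.
  intros Hx Hy Hn Hxy; rewrite <- (unit_iso x n m), <- (unit_iso y n m) by auto.
  now apply (iso_mono n m).
Qed.

Lemma unit_const p : unitpt Q H (fun _ => p).
Proof. intros n; reflexivity. Qed.

(** König's lemma. *)
Lemma units_compact (good : nat -> G -> Prop) :
  (forall n u v, iso_cls Q H n u v -> good n u -> good n v) ->
  (forall n u, good n u -> good (S n) u) ->
  (forall x, unitpt Q H x -> exists n, good n (x n)) ->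
  exists n, forall u, good n u.
Proof.
  intros Hiso Hmono Hpt; apply NNPP; intros Hnot.
  assert (Hmono' : forall n m u, (n <= m)%nat -> good n u -> good m u).
  { intros n m u Hn Hg; induction Hn; auto. }
  (* Level [n] has finitely many classes. If each had a level at which all its members in [A] are
     good, the largest of these levels would serve all of [A]. *)
  assert (Hpigeon : forall (A : G -> Prop) n,
    (forall m, exists v, A v /\ ~ good m v) ->
    exists w, forall m, exists v, A v /\ iso_cls Q H n v w /\ ~ good m v).
  { intros A n HA; apply NNPP; intros Hno.
    destruct (iso_finite n) as [reps Hr].
    assert (HM : exists M, forall w, In w reps ->
      forall v, A v -> iso_cls Q H n v w -> good M v).
    { clear Hr; induction reps as [|w reps [M IH]]; [exists 0%nat; intros w []|].
      destruct (not_all_ex_not _ _ (not_ex_all_not _ _ Hno w)) as [m Hm].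
      exists (Nat.max m M); intros w' [<-|Hw'] v Av Hv.
      - apply (Hmono' m); [lia|]; apply NNPP; intros Hg; apply Hm; eauto.
      - apply (Hmono' M); [lia|]; eauto. }
    destruct HM as [M HM], (HA M) as [v [Av Hv]], (Hr v) as [w [Hw Hvw]].
    apply Hv; eauto. }
  (* A bad class contains vertices that fail at arbitrarily high levels; the bad classes form the
     infinite tree in which a branch [x] is chosen. *)
  set (bad := fun n u => forall m, exists v, iso_cls Q H n v u /\ ~ good m v).
  assert (Hstep : forall n u, bad n u -> exists w, iso_cls Q H n w u /\ bad (S n) w).
  { intros n u Hu; destruct (Hpigeon _ (S n) Hu) as [w Hw]; exists w; split.
    - destruct (Hw 0%nat) as [v [Hvu [Hvw _]]].
      rewrite <- Hvu; symmetry; apply (iso_mono n (S n)); auto.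
    - intros m; destruct (Hw m) as [v [_ Hv]]; eauto. }
  assert (Hstart : exists u, bad 0%nat u).
  { destruct (Hpigeon (fun _ => True) 0%nat) as [u Hu].
    - intros m; destruct (not_all_ex_not _ _ (not_ex_all_not _ _ Hnot m)) as [v Hv]; eauto.
    - exists u; intros m; destruct (Hu m) as [v [_ Hv]]; eauto. }
  destruct Hstart as [u0 Hu0].
  set (next := fun n u => epsilon (inhabits u)
    (fun w => iso_cls Q H n w u /\ bad (S n) w)).
  set (x := nat_rect (fun _ => G) u0 next).
  assert (Hx : forall n, bad n (x n)).
  { induction n as [|n IH]; [exact Hu0|].
    apply (epsilon_spec (inhabits (x n)) _ (Hstep n (x n) IH)). }
  destruct (Hpt x) as [n Hn].
  - intros n; apply (epsilon_spec (inhabits (x n)) _ (Hstep n (x n) (Hx n))).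
  (* Badness of [x n], taken at level [n] itself, contradicts the invariance of [good n] under
     isomorphism. *)
  - destruct (Hx n n) as [v [Hv Hg]]; apply Hg, (Hiso n (x n)); [now symmetry|exact Hn].
Qed.

(** * The groupoid *)

Definition same_arrow (x : nat -> G) (g g' : G) : Prop :=
  exists N, forall n, (N <= n)%nat -> ceq H (mul g (x n)) (mul g' (x n)).

(** For [m >= n] the [n]-balls at [x m] and [x n] are isomorphic, and such a ball already decides
    whether the two short words end at the same vertex. *)
Lemma same_arrow_level x g g' i j n :
  unitpt Q H x -> wle g i -> wle g' j -> (i + j <= 2 * n + 1)%nat ->
  (same_arrow x g g' <-> ceq H (mul g (x n)) (mul g' (x n))).
Proof.
  intros Hx Hg Hg' Hn.
  assert (E : forall m, (n <= m)%nat ->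
    (ceq H (mul g (x m)) (mul g' (x m)) <-> ceq H (mul g (x n)) (mul g' (x n)))).
  { intros m Hm; apply (iso_vertices n _ _ _ _ i j); auto; now apply unit_iso. }
  split.
  - intros [N HN]; apply (E (Nat.max n N)); [lia|]; apply HN; lia.
  - intros Hc; exists n; intros m Hm; now apply E.
Qed.

#[local] Instance same_arrow_equiv x : Equivalence (same_arrow x).
Proof.
  split.
  - intros g; exists 0%nat; reflexivity.
  - intros g g' [N HN]; exists N; intros n Hn; symmetry; auto.
  - intros g1 g2 g3 [N HN] [M HM]; exists (Nat.max N M); intros n Hn.
    rewrite HN by lia; apply HM; lia.
Qed.

#[local] Instance ueqv_equiv : Equivalence (ueqv Q H).
Proof.
  split.
  - intros x n; reflexivity.
  - intros x y Hxy n; now symmetry.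
  - intros x y z Hxy Hyz n; transitivity (y n); [apply Hxy|apply Hyz].
Qed.

Lemma same_arrow_ueqv x y g g' : ueqv Q H x y -> same_arrow x g g' -> same_arrow y g g'.
Proof.
  intros Hxy [N HN]; exists (Nat.max N (wordlen Q g + wordlen Q g')); intros n Hn.
  apply (iso_vertices n (x n) (y n) g g' (wordlen Q g) (wordlen Q g'));
    [apply Hxy|apply wle_wordlen|apply wle_wordlen|lia|apply HN; lia].
Qed.

#[local] Instance arr_eqv_equiv : Equivalence (arr_eqv Q H).
Proof.
  split.
  - intros a; split; [reflexivity|exists 0%nat; reflexivity].
  - intros a b [Hu Hs]; split; [now symmetry|].
    apply (same_arrow_ueqv (fst a)); [exact Hu|]; now symmetry.
  - intros a b c [Hu Hs] [Hu' Hs']; split; [now transitivity (fst b)|].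
    change (same_arrow (fst a) (snd a) (snd c)); transitivity (snd b); [exact Hs|].
    apply (same_arrow_ueqv (fst b)); [now symmetry|exact Hs'].
Qed.

Lemma arr_eqv_same x g g' : arr_eqv Q H (x, g) (x, g') <-> same_arrow x g g'.
Proof. split; [intros [_ Hs]; exact Hs|split; [reflexivity|assumption]]. Qed.

Lemma ueqv_arr_eqv x y g : ueqv Q H x y -> arr_eqv Q H (x, g) (y, g).
Proof. intros Hxy; split; [exact Hxy|exists 0%nat; reflexivity]. Qed.

(** The shift by [wordlen Q g] in [src] pays for the loss in [agree_mul]. *)
Lemma unit_src x g : unitpt Q H x -> unitpt Q H (src Q (x, g)).
Proof.
  intros Hx n; unfold src; simpl fst; simpl snd; apply iso_cls_agree.
  apply (agree_mul _ _ _ _ (wordlen Q g)); [apply wle_wordlen|].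
  apply (agree_mono _ (2 * (n + wordlen Q g) + 1)); [lia|].
  apply iso_cls_agree, Hx.
Qed.

(** * Topology of the groupoid: cylinders and bisections *)

Lemma basic_eqv t a b : arr_eqv Q H a b -> basic Q H t a -> basic Q H t b.
Proof.
  destruct t as [[N c] g]; intros Hab [Hg [x [Hx Hc]]]; split; [exact Hg|].
  exists x; split; [now rewrite <- Hab|exact Hc].
Qed.

Lemma cylinder_all {X : Type} (P : X -> (nat -> G) -> Prop) (l : list X) x :
  unitpt Q H x ->
  (forall t, In t l -> exists N, forall y, unitpt Q H y ->
    iso_cls Q H N (y N) (x N) -> P t y) ->
  exists N, forall t y, In t l -> unitpt Q H y -> iso_cls Q H N (y N) (x N) -> P t y.
Proof.
  intros Hx; induction l as [|t l IH]; intros Hl; [exists 0%nat; intros t y []|].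
  destruct IH as [N HN]; [intros s Hs; apply Hl; now right|].
  destruct (Hl t (or_introl eq_refl)) as [M HM].
  exists (N + M)%nat; intros s y [<-|Hs] Hy Hyx.
  - apply HM; auto; apply (unit_iso_mono x y M (N + M)); auto; lia.
  - apply HN; auto; apply (unit_iso_mono x y N (N + M)); auto; lia.
Qed.

(** A basic set around [(x, g)] may name the arrow by another element [h]; the identification of [g]
    with [h] persists over a cylinder around [x]. *)
Lemma nbhd_cylinder x g V :
  unitpt Q H x -> nbhd Q H (x, g) V ->
  exists N, forall y, unitpt Q H y -> iso_cls Q H N (y N) (x N) -> V (y, g).
Proof.
  intros Hx [L [HL HV]].
  destruct (cylinder_all (fun t y => basic Q H t (y, g)) L x Hx) as [N HN].
  - intros t Ht; apply HL in Ht; destruct t as [[M c] h].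
    destruct Ht as [Hh [x' [[Hxx' Hs] Hc]]]; cbn [fst snd] in Hxx', Hs.
    (* Since [h] has length at most [M], this level decides whether [g] and [h] give the same
       arrow. *)
    exists (M + wordlen Q g)%nat; intros y Hy Hyx.
    split; [exact Hh|]; exists y; split.
    + apply arr_eqv_same.
      assert (Hw : forall z, unitpt Q H z -> (same_arrow z g h <->
        ceq H (mul g (z (M + wordlen Q g)%nat)) (mul h (z (M + wordlen Q g)%nat)))).
      { intros z Hz; apply (same_arrow_level z g h (wordlen Q g) (wordlen Q h)); auto;
          try apply wle_wordlen; lia. }
      apply Hw; [exact Hy|]; apply Hw in Hs; [|exact Hx].
      refine (proj2 (iso_vertices _ _ _ g h (wordlen Q g) (wordlen Q h) Hyx _ _ _) Hs);
        try apply wle_wordlen; lia.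
    + transitivity (x M); [apply (unit_iso_mono x y M (M + wordlen Q g)); auto; lia|].
      transitivity (x' M); [apply Hxx'|exact Hc].
  - exists N; intros y Hy Hyx; apply HV; [exact Hy|]; intros t Ht; auto.
Qed.

Lemma cylinder_nbhd a N (V : arrow G -> Prop) :
  is_arrow Q H a ->
  (forall b, is_arrow Q H b -> iso_cls Q H N (fst b N) (fst a N) ->
    same_arrow (fst b) (snd b) (snd a) -> V b) ->
  nbhd Q H a V.
Proof.
  intros Ha HV; set (M := (N + wordlen Q (snd a))%nat).
  exists [(M, fst a M, snd a)]; split.
  - intros t [<-|[]]; split; [lia|].
    exists (fst a); split; [destruct a; reflexivity|reflexivity].
  - intros b Hb Ht; destruct (Ht _ (or_introl eq_refl)) as [_ [y [[Hy Hs] Hc]]].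
    apply HV; [exact Hb| |exact Hs].
    apply (unit_iso_mono _ _ N M); [exact Ha|exact Hb|lia|].
    transitivity (y M); [apply Hy|exact Hc].
Qed.

(** The compact open bisection of all arrows [(x, g)], written so as to be invariant under
    [arr_eqv]. *)
Definition bisection (g : G) (a : arrow G) : Prop := same_arrow (fst a) (snd a) g.

Lemma bisection_eqv g a b : arr_eqv Q H a b -> (bisection g a <-> bisection g b).
Proof.
  intros [Hu Hs]; unfold bisection; change (same_arrow (fst a) (snd a) (snd b)) in Hs; split; intros Hg.
  - apply (same_arrow_ueqv (fst a)); [exact Hu|]; now rewrite <- Hs.
  - rewrite Hs; apply (same_arrow_ueqv (fst b)); [now symmetry|exact Hg].
Qed.

Lemma bisection_nbhd g a : is_arrow Q H a ->
  nbhd Q H a (fun b => bisection g b <-> bisection g a).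
Proof.
  intros Ha; set (N := (wordlen Q g + wordlen Q (snd a))%nat).
  apply (cylinder_nbhd a N); [exact Ha|]; intros b Hb Hba Hs; unfold bisection.
  rewrite Hs.
  assert (Hlvl : forall z, unitpt Q H z -> (same_arrow z (snd a) g <->
    ceq H (mul (snd a) (z N)) (mul g (z N)))).
  { intros z Hz; apply (same_arrow_level z _ _ (wordlen Q (snd a)) (wordlen Q g)); auto;
      try apply wle_wordlen; lia. }
  rewrite (Hlvl (fst b) Hb), (Hlvl (fst a) Ha).
  apply (iso_vertices N _ _ _ _ (wordlen Q (snd a)) (wordlen Q g)); auto;
    try apply wle_wordlen; lia.
Qed.

(** Over each unit finitely many open sets cover the arrows labelled by [gs], hence also over a
    cylinder around it. [units_compact] gives one level for all cylinders, and that level has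
    finitely many classes. *)
Lemma bisections_compact (gs : list G) :
  arr_compact Q H (fun a => exists g, In g gs /\ bisection g a).
Proof.
  intros I U HU Hcov.
  (* Open sets are unions of classes of arrows because basic sets are. *)
  assert (HUeqv : forall i a b, is_arrow Q H a -> is_arrow Q H b ->
    arr_eqv Q H a b -> U i a -> U i b).
  { intros i a b Ha Hb Hab Ui; destruct (HU i a Ha Ui) as [L [HL HV]].
    apply HV; [exact Hb|]; intros t Ht; apply (basic_eqv t a b Hab); auto. }
  set (good := fun N c => exists is : list I, forall x g, unitpt Q H x ->
    iso_cls Q H N (x N) c -> In g gs -> exists i, In i is /\ U i (x, g)).
  destruct (units_compact good) as [N HN].
  - intros n u v Huv [is His]; exists is; intros x g Hx Hxv Hg.
    apply His; auto; now rewrite Huv.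
  - intros n u [is His]; exists is; intros x g Hx Hxu Hg.
    apply His; auto; rewrite <- (unit_iso x n (S n)) by auto; now apply (iso_mono n (S n)); auto.
  - intros x Hx; unfold good.
    assert (Hg : forall g, In g gs -> exists i, U i (x, g)).
    { intros g Hg; apply Hcov; [exact Hx|].
      exists g; split; [exact Hg|exact (reflexivity (R := same_arrow x) g)]. }
    assert (His : exists is : list I, forall g, In g gs -> exists i, In i is /\ U i (x, g)).
    { clear Hcov good; induction gs as [|g gs' IH]; [exists []; intros g []|].
      destruct IH as [is His]; [intros h Hh; apply Hg; now right|].
      destruct (Hg g (or_introl eq_refl)) as [i Hi]; exists (i :: is).
      intros h [<-|Hh]; [exists i; split; [now left|exact Hi]|].
      destruct (His h Hh) as [j [Hj Uj]]; exists j; split; [now right|exact Uj]. }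
    destruct His as [is His].
    destruct (cylinder_all (fun g y => exists i, In i is /\ U i (y, g)) gs x Hx) as [N HN].
    + intros g Hg'; destruct (His g Hg') as [i [Hi Ui]].
      destruct (nbhd_cylinder x g (U i) Hx (HU i (x, g) Hx Ui)) as [N HN].
      exists N; eauto.
    + exists N, is; intros y g Hy Hyx Hg'; now apply HN.
  - destruct (iso_finite N) as [reps Hr].
    set (pick := fun c => epsilon (inhabits []) (fun is : list I => forall x g,
      unitpt Q H x -> iso_cls Q H N (x N) c -> In g gs -> exists i, In i is /\ U i (x, g))).
    exists (flat_map pick reps); intros a Ha [g [Hg Hs]].
    destruct (Hr (fst a N)) as [c [Hc Hac]].
    destruct (epsilon_spec (inhabits []) _ (HN c) (fst a) g Ha Hac Hg) as [i [Hi Ui]].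
    exists i; split; [apply in_flat_map; exists c; auto|].
    apply (HUeqv i (fst a, g)); auto; destruct a as [x h]; symmetry.
    now apply arr_eqv_same.
Qed.

(** The arrows represented by an element of length at most [k] form an open set, and these sets
    increase with [k] to the whole groupoid. *)
Lemma compact_bounded K : arr_compact Q H K ->
  exists k, forall a, is_arrow Q H a -> K a -> exists g, wle g k /\ bisection g a.
Proof.
  intros HK.
  destruct (HK nat (fun k a => exists g, wle g k /\ bisection g a)) as [ks Hks].
  - intros k a Ha [g [Hg Hga]].
    destruct (bisection_nbhd g a Ha) as [L [HL HV]]; exists L; split; [exact HL|].
    intros b Hb Hbt; exists g; split; [exact Hg|]; now apply (HV b Hb Hbt).
  - intros a _ _; exists (wordlen Q (snd a)), (snd a); split; [apply wle_wordlen|].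
    exact (reflexivity (R := same_arrow _) _).
  - exists (list_max ks); intros a Ha Ka; destruct (Hks a Ha Ka) as [k [Hk [g [Hg Hga]]]].
    exists g; split; [|exact Hga]; apply (wle_mono _ k); [|exact Hg].
    exact (proj1 (Forall_forall _ _) (proj1 (list_max_le ks _) (le_n _)) k Hk).
Qed.

(** * Local property A implies amenability *)

Lemma unit_ueqv x y : ueqv Q H x y -> unitpt Q H x -> unitpt Q H y.
Proof.
  intros Hxy Hx n; transitivity (x (S n)); [apply (iso_mono n (S n)); auto; symmetry; apply Hxy|].
  transitivity (x n); [apply Hx|apply Hxy].
Qed.

(** * Probability systems from local densities on the vertices *)

Section Density.
Variables (σ : G -> G -> R) (K : nat).
Hypothesis σ_ceq : forall x x' y y', ceq H x x' -> ceq H y y' -> σ x y = σ x' y'.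
Hypothesis σ_nonneg : forall x y, 0 <= σ x y.
Hypothesis σ_sum : forall x, sum_nonneg (fun _ => True) (ceq H) (σ x) 1.
Hypothesis σ_support : forall x y, σ x y <> 0 -> exists g, wle g K /\ ceq H (mul g x) y.
Hypothesis σ_local : forall u v g,
  iso_cls Q H K u v -> wle g K -> σ u (mul g u) = σ v (mul g v).

(** Extends [σ_local] to long [g]. Level [K + j] decides whether [g u] is reached by a word of
    length at most [K]: if so, [σ_local] applies, and if not, both values vanish. *)
Lemma density_transfer u v g j :
  iso_cls Q H (K + j) u v -> wle g j -> σ u (mul g u) = σ v (mul g v).
Proof.
  intros Huv Hg.
  assert (E : forall h, wle h K ->
    (ceq H (mul h u) (mul g u) <-> ceq H (mul h v) (mul g v))).
  { intros h Hh; apply (iso_vertices (K + j) _ _ _ _ K j); auto; lia. }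
  destruct (classic (exists h, wle h K /\ ceq H (mul h u) (mul g u))) as [[h [Hh Hc]]|Hn].
  - rewrite <- (σ_ceq u u (mul h u) (mul g u)) by (auto; reflexivity).
    rewrite <- (σ_ceq v v (mul h v) (mul g v)) by (try apply E; auto; reflexivity).
    apply σ_local; auto; apply (iso_mono K (K + j)); auto; lia.
  - transitivity 0; [|symmetry]; apply NNPP; intros H0; apply σ_support in H0 as [h [Hh Hc]];
      apply Hn; exists h; split; auto; now apply E.
Qed.

(** From level [K + wordlen] on, the value no longer depends on the level. *)
Definition density (a : arrow G) : R :=
  let n := (K + wordlen Q (snd a))%nat in σ (fst a n) (mul (snd a) (fst a n)).

Lemma density_level x g n :
  unitpt Q H x -> (K + wordlen Q g <= n)%nat -> density (x, g) = σ (x n) (mul g (x n)).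
Proof.
  intros Hx Hn; unfold density; simpl.
  apply (density_transfer _ _ g (wordlen Q g)); [|apply wle_wordlen].
  symmetry; now apply unit_iso.
Qed.

Lemma density_respects : arr_respects Q H density.
Proof.
  intros [x g] [y h] Hx Hab; unfold is_arrow in Hx; simpl in Hx.
  assert (Hxy := proj1 Hab); simpl in Hxy.
  assert (Hs : same_arrow x g h) by exact (proj2 Hab).
  set (n := (K + wordlen Q g + wordlen Q h)%nat).
  assert (Hy := unit_ueqv x y Hxy Hx).
  rewrite (density_level x g n), (density_level y h n) by (auto; lia).
  rewrite (density_transfer (x n) (y n) g (wordlen Q g + wordlen Q h)).
  - apply σ_ceq; [reflexivity|].
    apply (same_arrow_level y g h (wordlen Q g) (wordlen Q h)); auto;
      try apply wle_wordlen; [lia|]; now apply (same_arrow_ueqv x).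
  - unfold n; rewrite <- Nat.add_assoc; apply Hxy.
  - apply (wle_mono _ (wordlen Q g)); [lia|apply wle_wordlen].
Qed.

Lemma density_support a : is_arrow Q H a -> density a <> 0 ->
  exists g, wle g K /\ same_arrow (fst a) (snd a) g.
Proof.
  intros Ha Hd; apply σ_support in Hd as [g [Hg Hc]]; exists g; split; [exact Hg|].
  apply (same_arrow_level _ _ _ (wordlen Q (snd a)) K (K + wordlen Q (snd a))); auto;
    [apply wle_wordlen|lia|now symmetry].
Qed.

(** One group element for each arrow over [x] that can carry mass. *)
Definition transversal (x : nat -> G) (l : list G) : Prop :=
  (forall g, In g l -> wle g K) /\ separated (same_arrow x) l /\
  forall g, wle g K -> exists h, In h l /\ same_arrow x g h.

Lemma transversal_exists x : exists l, transversal x l.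
Proof.
  destruct (separated_reps (same_arrow x) (words K)) as [l [Hi [Hs Hr]]].
  exists l; split; [|split]; auto.
  - intros g Hg; apply words_spec; auto.
  - intros g Hg; apply Hr; now apply words_spec.
Qed.

(** Coincidences among words of length at most [K] are decided at level [K], so one finite list
    computes the fibre sums over a whole cylinder. *)
Lemma transversal_iso x y l : unitpt Q H x -> unitpt Q H y ->
  iso_cls Q H K (y K) (x K) -> transversal x l -> transversal y l.
Proof.
  intros Hx Hy Hyx [Hl [Hs Hr]].
  assert (E : forall g h, wle g K -> wle h K -> (same_arrow x g h <-> same_arrow y g h)).
  { intros g h Hg Hh.
    rewrite (same_arrow_level x g h K K K), (same_arrow_level y g h K K K) by (auto; lia).
    symmetry; apply (iso_vertices K _ _ _ _ K K); auto; lia. }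
  split; [exact Hl|split].
  - rewrite <- (map_id l); apply (separated_map (same_arrow x)); [|exact Hs].
    intros g h Hg Hh; apply E; auto.
  - intros g Hg; destruct (Hr g Hg) as [h [Hh Hgh]]; exists h; split; [exact Hh|].
    apply E; auto.
Qed.

Lemma transversal_fiber x l : unitpt Q H x -> transversal x l ->
  let L := map (fun g => (x, g)) l in
  (forall a, In a L -> fiber Q H x a) /\ separated (arr_eqv Q H) L /\
  forall a, fiber Q H x a -> density a <> 0 -> exists b, In b L /\ arr_eqv Q H a b.
Proof.
  intros Hx [Hl [Hs Hr]] L; split; [|split].
  - intros a Ha; apply in_map_iff in Ha as [g [<- _]]; split; [exact Hx|].
    unfold rng; simpl; reflexivity.
  - apply (separated_map (same_arrow x)); [|exact Hs].
    intros g h _ _; apply arr_eqv_same.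
  - intros [y h] [Hy Hyx] Hd; unfold rng in Hyx; simpl in Hyx.
    destruct (density_support (y, h) Hy Hd) as [g [Hg Hs']]; simpl in Hs'.
    destruct (Hr g Hg) as [k [Hk Hgk]]; exists (x, k); split.
    + apply in_map_iff; exists k; auto.
    + split; [exact Hyx|]; change (same_arrow y h k).
      rewrite Hs'; apply (same_arrow_ueqv x); [now symmetry|exact Hgk].
Qed.

Lemma transversal_sum x l : unitpt Q H x -> transversal x l ->
  lsum (fun g => density (x, g)) l = 1.
Proof.
  intros Hx [Hl [Hs Hr]]; set (n := (K + K)%nat).
  apply (sum_nonneg_unique (ceq H) (fun _ => True) (σ (x n))); [|apply σ_sum].
  replace (lsum (fun g => density (x, g)) l)
    with (lsum (σ (x n)) (map (fun g => mul g (x n)) l)).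
  - assert (Hn : forall g h, wle g K -> wle h K ->
      (same_arrow x g h <-> ceq H (mul g (x n)) (mul h (x n)))).
    { intros g h Hg Hh; apply (same_arrow_level x g h K K n); auto; lia. }
    apply (sum_nonneg_reps (ceq H)); auto.
    + apply (separated_map (same_arrow x)); [|exact Hs].
      intros g h Hg Hh; apply Hn; auto.
    + intros z _ Hz; apply σ_support in Hz as [g [Hg Hc]].
      destruct (Hr g Hg) as [h [Hh Hgh]]; exists (mul h (x n)).
      assert (Hzh : ceq H z (mul h (x n))) by (rewrite <- Hc; apply Hn; auto).
      split; [apply in_map_iff; eauto|split; [exact Hzh|]].
      apply σ_ceq; [reflexivity|exact Hzh].
  - rewrite lsum_map; apply lsum_ext; intros g Hg; symmetry; apply density_level; auto.
    apply Nat.add_le_mono_l, wordlen_le; auto.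
Qed.

Lemma density_system : cont_prob_system Q H density.
Proof.
  split; [exact density_respects|split; [intros; apply σ_nonneg|split]].
  - intros x Hx; destruct (transversal_exists x) as [l Hl].
    destruct (transversal_fiber x l Hx Hl) as [HA [Hs Hr]].
    rewrite <- (transversal_sum x l Hx Hl), <- (lsum_map (fun g => (x, g)) density l).
    apply (sum_nonneg_reps (arr_eqv Q H)); auto.
    + intros; apply σ_nonneg.
    + intros a Ha Hd; destruct (Hr a Ha Hd) as [b [Hb Hab]]; exists b; repeat split; auto.
      all: try apply Hab.
      apply density_respects; [apply Ha|exact Hab].
  - intros f [Hresp [Hcont _]].
    assert (Hsum : forall x l, unitpt Q H x -> transversal x l ->
      sum_signed (fiber Q H x) (arr_eqv Q H) (fun a => f a * density a)
        (lsum (fun g => f (x, g) * density (x, g)) l)).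
    { intros x l Hx Hl; destruct (transversal_fiber x l Hx Hl) as [HA [Hs Hr]].
      rewrite <- (lsum_map (fun g => (x, g)) (fun a => f a * density a) l).
      apply (sum_signed_reps (arr_eqv Q H)); auto.
      intros a Ha Hfd; destruct (Hr a Ha) as [b [Hb Hab]].
      - intros Hd; apply Hfd; rewrite Hd; ring.
      - exists b; split; [exact Hb|split; [exact Hab|]].
        rewrite (Hresp a b), (density_respects a b); auto; apply Ha. }
    set (φ := fun x => epsilon (inhabits 0) 
      (sum_signed (fiber Q H x) (arr_eqv Q H) (fun a => f a * density a))).
    assert (Hφ : forall x, unitpt Q H x ->
      sum_signed (fiber Q H x) (arr_eqv Q H) (fun a => f a * density a) (φ x)).
    { intros x Hx; unfold φ; apply epsilon_spec.
      destruct (transversal_exists x) as [l Hl]; eauto. }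
    exists φ; split; [exact Hφ|].
    intros x Hx eps Heps; destruct (transversal_exists x) as [l Hl].
    destruct (cylinder_all (fun g y => Rabs (f (y, g) - f (x, g)) < eps / 2) l x Hx)
      as [N HN].
    { intros g _; apply (nbhd_cylinder x g (fun b => Rabs (f b - f (x, g)) < eps / 2)); auto.
      apply Hcont; [exact Hx|lra]. }
    exists (N + (K + K))%nat; intros y Hy Hyx.
    assert (Hyl : transversal y l).
    { apply (transversal_iso x); auto.
      apply (unit_iso_mono x y K (N + (K + K))); auto; lia. }
    rewrite (sum_signed_unique _ _ _ _ _ (Hφ x Hx) (Hsum x l Hx Hl)).
    rewrite (sum_signed_unique _ _ _ _ _ (Hφ y Hy) (Hsum y l Hy Hyl)).
    rewrite <- lsum_minus; eapply Rle_lt_trans; [apply lsum_Rabs|].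
    apply Rle_lt_trans with (lsum (fun g => eps / 2 * density (x, g)) l).
    + apply lsum_le; intros g Hg.
      assert (Hgl : (wordlen Q g <= K)%nat) by now apply wordlen_le, Hl.
      rewrite (density_level x g (K + K)), (density_level y g (K + K)) by (auto; lia).
      rewrite (density_transfer (y (K + K)%nat) (x (K + K)%nat) g K).
      * rewrite <- Rmult_minus_distr_r, Rabs_mult, (Rabs_pos_eq (σ _ _)) by apply σ_nonneg.
        apply Rmult_le_compat_r; [apply σ_nonneg|left].
        apply HN; auto; apply (unit_iso_mono x y N (N + (K + K))); auto; lia.
      * apply (unit_iso_mono x y (K + K) (N + (K + K))); auto; lia.
      * now apply Hl.
    + rewrite lsum_scal, (transversal_sum x l Hx Hl); lra.
Qed.

(** The source of [(x, g)] at level [n - wordlen Q g] is the vertex [g x_n], and there [h] times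
    [inv g] leads to [h x_n]. *)
Lemma density_translate x g y h n :
  unitpt Q H x -> (K + wordlen Q g + wordlen Q (mul h (inv g)) <= n)%nat ->
  density (amul (ainv Q (x, g)) (y, h)) = σ (mul g (x n)) (mul h (x n)).
Proof.
  intros Hx Hn; unfold amul, ainv; cbn [fst snd].
  rewrite (density_level _ _ (n - wordlen Q g)%nat); [|now apply unit_src|lia].
  unfold src; cbn [fst snd]; rewrite Nat.sub_add by lia; now gsimp.
Qed.

(** A finite partial sum over the fibre becomes a sum over vertices at any level beyond the lengths
    of all arrows involved. *)
Lemma density_invariance x g b N :
  unitpt Q H x ->
  (forall n lz, (N <= n)%nat -> separated (ceq H) lz ->
    lsum (fun z => Rabs (σ (mul g (x n)) z - σ (x n) z)) lz <= b) ->
  exists s, sum_nonneg (fiber Q H (rng (x, g))) (arr_eqv Q H)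
    (fun h => Rabs (density (amul (ainv Q (x, g)) h) - density h)) s /\ s <= b.
Proof.
  intros Hx Hb; apply sum_nonneg_bounded; intros L HL Hs; unfold rng in HL; simpl in HL.
  set (len := fun a : arrow G => (wordlen Q (snd a) + wordlen Q (mul (snd a) (inv g)))%nat).
  set (B := list_max (map len L)).
  assert (HB : forall a, In a L -> (len a <= B)%nat).
  { intros a Ha.
    exact (proj1 (Forall_forall _ _) (proj1 (list_max_le (map len L) B) (le_n _)) _
      (in_map len L a Ha)). }
  unfold len in HB; set (n := (N + K + wordlen Q g + B)%nat).
  apply Rle_trans with
    (lsum (fun z => Rabs (σ (mul g (x n)) z - σ (x n) z)) (map (fun a => mul (snd a) (x n)) L)).
  - right; rewrite lsum_map; apply lsum_ext; intros [y h] Ha.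
    destruct (HL _ Ha) as [Hy Hyx]; unfold rng in Hyx; simpl in Hyx.
    specialize (HB _ Ha); cbn [fst snd] in HB |- *.
    rewrite (density_translate x g y h n) by (auto; lia).
    rewrite (density_respects (y, h) (x, h)) by (auto; now apply ueqv_arr_eqv).
    rewrite (density_level x h n) by (auto; lia); reflexivity.
  - apply Hb; [lia|]; apply (separated_map (arr_eqv Q H)); [|exact Hs].
    intros [y h] [z k] Ha Ha' Hc; cbn [fst snd] in Hc.
    assert (HBa := HB _ Ha); assert (HBa' := HB _ Ha'); cbn [fst snd] in HBa, HBa'.
    destruct (HL _ Ha) as [Hy Hyx]; destruct (HL _ Ha') as [Hz Hzx].
    unfold rng in Hyx, Hzx; simpl in Hyx, Hzx.
    split; [simpl; now transitivity x; [|symmetry]|].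
    change (same_arrow y h k); apply (same_arrow_ueqv x); [now symmetry|].
    apply (same_arrow_level x h k (wordlen Q h) (wordlen Q k) n); auto;
      try apply wle_wordlen; lia.
Qed.

End Density.

(** AM-GM for [|a - b| |a + b|]; the weight [n] suits [||a - b||_2 <= 1 / n]. *)
Lemma Rabs_sqr_diff n a b : 0 < n ->
  Rabs (a ^ 2 - b ^ 2) <= n * (a - b) ^ 2 + (a ^ 2 + b ^ 2) / (2 * n).
Proof.
  intros Hn.
  assert (E : forall c, c = 1 \/ c = -1 ->
    n * (a - b) ^ 2 + (a ^ 2 + b ^ 2) / (2 * n) - c * (a ^ 2 - b ^ 2) =
    ((n * (a - b) - c * (a + b) / 2) ^ 2 + (a - b) ^ 2 / 4) / n).
  { intros c Hc; destruct Hc as [-> | ->]; field; lra. }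
  assert (Hpos : forall c, 0 <= ((n * (a - b) - c * (a + b) / 2) ^ 2 + (a - b) ^ 2 / 4) / n).
  { intros c; apply Rle_mult_inv_pos; [|exact Hn].
    generalize (pow2_ge_0 (n * (a - b) - c * (a + b) / 2)), (pow2_ge_0 (a - b)); lra. }
  generalize (E 1 (or_introl eq_refl)) (E (-1) (or_intror eq_refl)) (Hpos 1) (Hpos (-1)).
  intros E1 E2 P1 P2; rewrite <- E1 in P1; rewrite <- E2 in P2.
  apply Rabs_le; lra.
Qed.

Lemma sqrt_le_sqr s b : 0 <= b -> sqrt s <= b -> s <= b ^ 2.
Proof.
  intros Hb Hs; destruct (Rle_or_lt s 0) as [H0|H0]; [generalize (pow2_ge_0 b); lra|].
  rewrite <- (pow2_sqrt s) by lra; apply pow_incr; split; [apply sqrt_pos|exact Hs].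
Qed.

Lemma property_A_amenable : local_property_A Q H -> topologically_amenable Q H.
Proof.
  intros HA C HC eps Heps.
  destruct (compact_bounded C HC) as [k Hk].
  destruct (INR_unbounded (2 / eps)) as [n0 Hn0].
  (* Large enough that arrows of [C] move vertices by at most [n] and that the final error
     [2 / INR n] is below [eps]. *)
  set (n := S (k + n0)).
  assert (Hn : 0 < INR n) by (apply lt_0_INR; lia).
  assert (Hneps : 2 / INR n < eps).
  { assert (INR n0 <= INR n) by (apply le_INR; lia).
    apply (Rmult_lt_reg_r (INR n)); [exact Hn|].
    replace (2 / INR n * INR n) with (2 / eps * eps) by (field; lra); nra. }
  destruct (HA n) as [ρ [Rn [_ [Hx [Hy [Hnorm [Hvar [Hsupp Hloc]]]]]]]]; [lia|].
  destruct (INR_unbounded Rn) as [K HK].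
  set (σ := fun x y => (ρ x y) ^ 2).
  assert (σ_ceq : forall x x' y y', ceq H x x' -> ceq H y y' -> σ x y = σ x' y').
  { intros x x' y y' Hxx Hyy; unfold σ; now rewrite (Hx x x' Hxx), (Hy x' y y' Hyy). }
  assert (σ_nonneg : forall x y, 0 <= σ x y) by (intros; apply pow2_ge_0).
  assert (σ_sum : forall x, sum_nonneg (fun _ => True) (ceq H) (σ x) 1).
  { intros x; destruct (Hnorm x) as [s [Hs Es]]; fold (σ x) in Hs.
    replace 1 with s; [exact Hs|].
    rewrite <- (pow2_sqrt s), Es; [ring|].
    (* The empty list shows that [s] is nonnegative, hence the square of its root. *)
    apply (lsum_le_sum_nonneg (ceq H) _ _ s [] Hs); [intros y []|constructor]. }
  assert (σ_support : forall x y, σ x y <> 0 -> exists g, wle g K /\ ceq H (mul g x) y).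
  { intros x y Hxy; assert (Hb : in_ball Q H Rn x y).
    { apply NNPP; intros Hb; apply Hxy; unfold σ; rewrite (Hsupp x y Hb); ring. }
    apply in_ball_iff in Hb as [g [j [Hj [Hg Hc]]]]; exists g; split; [|exact Hc].
    apply (wle_mono _ j); [apply INR_le; lra|exact Hg]. }
  assert (σ_local : forall u v g,
    iso_cls Q H K u v -> wle g K -> σ u (mul g u) = σ v (mul g v)).
  { intros u v g Huv Hg.
    (* A nonzero value places the vertex inside the ball of radius [Rn], where the locality of [ρ]
       applies. *)
    assert (Hhalf : forall u v, iso_cls Q H K u v -> σ u (mul g u) <> 0 ->
      σ u (mul g u) = σ v (mul g v)).
    { clear u v Huv; intros u v Huv H0.
      destruct (agree_root_label_iso K Rn u v) as [θ [Hθ Hg']];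
        [now apply iso_cls_agree|lra|].
      unfold σ; rewrite <- (Hy v _ _ (Hg' g Hg)), (Hloc u v θ Hθ); [reflexivity|].
      apply NNPP; intros Hb; apply H0; unfold σ; rewrite (Hsupp _ _ Hb); ring. }
    destruct (Req_dec (σ u (mul g u)) 0) as [Hu|Hu]; [|now apply Hhalf].
    destruct (Req_dec (σ v (mul g v)) 0) as [Hv|Hv]; [congruence|].
    symmetry; apply Hhalf; [now symmetry|exact Hv]. }
  exists (density σ K); split; [now apply density_system|].
  intros [x g] Hg Cg; unfold is_arrow in Hg; simpl in Hg.
  destruct (Hk (x, g) Hg Cg) as [h [Hh Hgh]]; unfold bisection in Hgh; simpl in Hgh.
  destruct (density_invariance σ K σ_ceq σ_support σ_local x g (2 / INR n)
    (k + wordlen Q g)%nat Hg) as [s [Hs Hsb]]; [|exists s; split; [exact Hs|lra]].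
  intros N lz HN Hlz; set (p := x N).
  (* At this level [g p = h p], so the inverse of the short element [h] leads back to [p]. *)
  assert (Hd : dist_le Q H (mul g p) p n).
  { destruct (wle_inv h k Hh) as [w [Hw [Hl E]]]; exists w; repeat split; [exact Hw|lia|].
    rewrite E; apply (ceq_mul h); gsimp.
    apply (same_arrow_level x g h (wordlen Q g) k N); auto; [apply wle_wordlen|lia]. }
  destruct (Hvar _ _ Hd) as [t [Ht Htn]].
  assert (Ht2 : t <= (1 / INR n) ^ 2).
  { apply sqrt_le_sqr; [|exact Htn]; left; apply Rdiv_lt_0_compat; lra. }
  apply Rle_trans with (lsum (fun z => INR n * (ρ (mul g p) z - ρ p z) ^ 2 +
    / (2 * INR n) * (σ (mul g p) z + σ p z)) lz).
  - apply lsum_le; intros z _; unfold σ.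
    eapply Rle_trans; [apply (Rabs_sqr_diff (INR n)); exact Hn|right; field; lra].
  - rewrite lsum_plus, !lsum_scal, lsum_plus.
    assert (B1 := lsum_le_sum_nonneg (ceq H) _ _ t lz Ht (fun _ _ => I) Hlz).
    assert (B2 := lsum_le_sum_nonneg (ceq H) _ _ 1 lz (σ_sum (mul g p)) (fun _ _ => I) Hlz).
    assert (B3 := lsum_le_sum_nonneg (ceq H) _ _ 1 lz (σ_sum p) (fun _ _ => I) Hlz).
    replace (2 / INR n) with (INR n * (1 / INR n) ^ 2 + / (2 * INR n) * (1 + 1))
      by (field; lra).
    apply Rplus_le_compat; apply Rmult_le_compat_l; try lra.
    left; apply Rinv_0_lt_compat; lra.
Qed.

(** * Amenability implies local property A *)

Lemma dec_iff (P P' : Prop) (a b : R) :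
  (P <-> P') -> (if dec P then a else b) = (if dec P' then a else b).
Proof. intros E; destruct (dec P), (dec P'); tauto. Qed.

Lemma bisection_indicator_Cc g : Cc Q H (fun a => if dec (bisection g a) then 1 else 0).
Proof.
  split; [|split].
  - intros a b _ Hab; now apply dec_iff, bisection_eqv.
  - intros a Ha eps Heps; destruct (bisection_nbhd g a Ha) as [L [HL HV]].
    exists L; split; [exact HL|]; intros b Hb Hbt.
    rewrite (dec_iff _ _ 1 0 (HV b Hb Hbt)), Rminus_diag, Rabs_R0; exact Heps.
  - exists (fun a => exists h, In h [g] /\ bisection h a); split; [apply bisections_compact|].
    intros a _ Hn; destruct (dec (bisection g a)) as [Hg|]; [|reflexivity].
    exfalso; apply Hn; exists g; split; [now left|exact Hg].
Qed.

Lemma system_continuous m g x eps :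
  cont_prob_system Q H m -> unitpt Q H x -> 0 < eps ->
  exists N, forall y, unitpt Q H y -> iso_cls Q H N (y N) (x N) ->
    Rabs (m (y, g) - m (x, g)) < eps.
Proof.
  intros [Hresp [Hpos [_ Hcont]]] Hx Heps.
  destruct (Hcont _ (bisection_indicator_Cc g)) as [φ [Hφ HC]].
  assert (E : forall y, unitpt Q H y -> φ y = m (y, g)).
  { intros y Hy.
    set (f := fun h => (if dec (bisection g h) then 1 else 0) * m h) in Hφ.
    (* The fibre over [y] meets the bisection in the single class of [(y, g)]. *)
    transitivity (lsum f [(y, g)]).
    - apply (sum_signed_unique _ _ _ _ _ (Hφ y Hy)), (sum_signed_reps (arr_eqv Q H)).
      + intros a [<-|[]]; split; [exact Hy|exact (reflexivity (R := ueqv Q H) y)].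
      + repeat constructor.
      + intros a [Ha Hay] Hfa; exists (y, g); split; [now left|].
        destruct (dec (bisection g a)) as [Hg|Hg];
          [|exfalso; apply Hfa; unfold f; destruct (dec _); [contradiction|ring]].
        assert (Hae : arr_eqv Q H a (y, g)) by (split; [exact Hay|exact Hg]).
        split; [exact Hae|]; unfold f.
        rewrite (dec_iff _ _ 1 0 (bisection_eqv g a (y, g) Hae)), (Hresp a (y, g)); auto.
    - unfold f; simpl; destruct (dec _) as [|Hn]; [ring|].
      exfalso; apply Hn; exact (reflexivity (R := same_arrow y) g). }
  destruct (HC x Hx eps Heps) as [N HN]; exists N; intros y Hy Hyx.
  rewrite <- !E by auto; now apply HN.
Qed.

(** Over a constant unit point [p] the fibre is the vertex set, [z] being
    reached by the arrow [(p, z p^-1)]. *)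
Definition vertex_mass (m : arrow G -> R) (p z : G) : R := m (fun _ => p, mul z (inv p)).

(** Image of the finite measure [l] on the group under the orbit map of the vertex [p]. *)
Definition push (l : list (G * R)) (p : G) : G -> R :=
  pmass (ceq H) (map (fun av => (mul (fst av) p, snd av)) l).

Lemma push_eq l p p' z z' :
  (forall av, In av l -> (ceq H (mul (fst av) p) z <-> ceq H (mul (fst av) p') z')) ->
  push l p z = push l p' z'.
Proof.
  intros E; unfold push, pmass; rewrite !lsum_map; apply lsum_ext; intros av Hav.
  apply dec_iff, E, Hav.
Qed.

(** * Vertex masses and their uniform finite approximation *)

Section VertexMass.
Variable m : arrow G -> R.
Hypothesis Hm : cont_prob_system Q H m.

Lemma vertex_mass_nonneg p z : 0 <= vertex_mass m p z.
Proof. apply Hm, unit_const. Qed.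

Lemma vertex_mass_ceq p p' z z' :
  ceq H p p' -> ceq H z z' -> vertex_mass m p z = vertex_mass m p' z'.
Proof.
  intros Hp Hz; apply Hm; [apply unit_const|split; [intros n; now apply ceq_iso|]].
  exists 0%nat; intros n _; cbn [fst snd].
  gsimp; rewrite Hp; gsimp; exact Hz.
Qed.

Lemma vertex_mass_le_1 p lz : separated (ceq H) lz -> lsum (vertex_mass m p) lz <= 1.
Proof.
  intros Hz; unfold vertex_mass.
  rewrite <- (lsum_map (fun z => (fun _ : nat => p, mul z (inv p))) m lz).
  apply (lsum_le_sum_nonneg (arr_eqv Q H) (fiber Q H (fun _ => p))).
  - apply Hm, unit_const.
  - intros a Ha; apply in_map_iff in Ha as [z [<- _]]; split; [apply unit_const|].
    exact (reflexivity (R := ueqv Q H) (fun _ => p)).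
  - apply (separated_map (ceq H)); [|exact Hz].
    intros z z' _ _ [_ [N HN]]; specialize (HN N (le_n N)); cbn [fst snd] in HN.
    now autorewrite with grp in HN.
Qed.

(** The source of [(p, g)] at a constant unit is the constant unit at [g p], so translating the mean
    by this arrow gives the vertex mass at [g p]. *)
Lemma vertex_mass_translate p g lz eps k :
  (forall a, is_arrow Q H a -> (exists h, In h (words k) /\ bisection h a) ->
    exists s, sum_nonneg (fiber Q H (rng a)) (arr_eqv Q H)
      (fun h => Rabs (m (amul (ainv Q a) h) - m h)) s /\ s < eps) ->
  wle g k -> separated (ceq H) lz ->
  lsum (fun z => Rabs (vertex_mass m (mul g p) z - vertex_mass m p z)) lz <= eps.
Proof.
  intros Hinv Hg Hz; destruct (Hinv (fun _ => p, g)) as [s [Hs Hse]].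
  - apply unit_const.
  - exists g; split; [now apply words_spec|exact (reflexivity (R := same_arrow _) g)].
  - left; eapply Rle_lt_trans; [|exact Hse].
    rewrite <- (lsum_le_sum_nonneg (arr_eqv Q H) _ _ s
      (map (fun z => (fun _ : nat => p, mul z (inv p))) lz) Hs).
    + rewrite lsum_map; right; apply lsum_ext; intros z _.
      unfold vertex_mass, amul, ainv, src; cbn [fst snd]; now gsimp.
    + intros a Ha; apply in_map_iff in Ha as [z [<- _]]; split; [apply unit_const|].
      exact (reflexivity (R := ueqv Q H) (fun _ => p)).
    + apply (separated_map (ceq H)); [|exact Hz].
      intros z z' _ _ [_ [N HN]]; specialize (HN N (le_n N)); cbn [fst snd] in HN.
      now autorewrite with grp in HN.
Qed.

(** The same [l] serves all vertices of the cylinder: this is what makes the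
    vectors [sqrt (push l p)] local. *)
Definition approximable (δ : R) (l : list (G * R)) (N : nat) (c : G) : Prop :=
  (forall av, In av l -> wle (fst av) N /\ 0 <= snd av) /\ lsum snd l = 1 /\
  forall p, iso_cls Q H N p c -> forall lz, separated (ceq H) lz ->
    lsum (fun z => Rabs (vertex_mass m p z - push l p z)) lz <= δ.

Lemma approximable_at x δ : unitpt Q H x -> 0 < δ ->
  exists N l, approximable δ l N (x N).
Proof.
  intros Hx Hδ; destruct Hm as [Hresp [Hpos [Hsum _]]].
  destruct (sum_nonneg_approx (arr_eqv Q H) _ _ _ (δ / 4) (Hsum x Hx)) as [L [HL [HLs HL1]]];
    [lra|].
  set (gs := map snd L).
  assert (Hgs : separated (same_arrow x) gs).
  { apply (separated_map (arr_eqv Q H)); [|exact HLs].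
    intros [y h] [z k] Ha Ha' Hs; cbn [fst snd] in Hs.
    destruct (HL _ Ha) as [Hy Hyx]; destruct (HL _ Ha') as [Hz Hzx].
    unfold rng in Hyx, Hzx; simpl in Hyx, Hzx.
    split; [simpl; now transitivity x; [|symmetry]|].
    apply (same_arrow_ueqv x); [now symmetry|exact Hs]. }
  set (v := fun g => m (x, g)).
  assert (Ev : lsum v gs = lsum m L).
  { unfold gs; rewrite lsum_map; apply lsum_ext; intros [y h] Ha.
    destruct (HL _ Ha) as [Hy Hyx]; symmetry; apply Hresp; [exact Hy|].
    now apply ueqv_arr_eqv. }
  assert (Hv1 : lsum v gs <= 1).
  { rewrite Ev; apply (lsum_le_sum_nonneg (arr_eqv Q H) (fiber Q H x)); auto. }
  (* Errors of η at all elements of [gs] add up to at most [δ / 4]; the added 1 keeps the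
     denominator positive. *)
  set (η := δ / 4 / (INR (length gs) + 1)).
  assert (Hlen := pos_INR (length gs)).
  assert (Hη : 0 < η) by (apply Rdiv_lt_0_compat; lra).
  destruct (cylinder_all (fun g y => Rabs (m (y, g) - m (x, g)) < η) gs x Hx) as [N1 HN1].
  { intros g _; now apply system_continuous. }
  set (N2 := list_max (map (wordlen Q) gs)).
  assert (HN2 : forall g, In g gs -> wle g (N1 + N2)).
  { intros g Hg; apply (wle_mono _ (wordlen Q g)); [|apply wle_wordlen].
    transitivity N2; [|lia].
    exact (proj1 (Forall_forall _ _) (proj1 (list_max_le _ N2) (le_n _)) _
      (in_map (wordlen Q) gs g Hg)). }
  set (l := map (fun g => (g, v g)) gs).
  (* The mass not captured by [gs] is put at the identity, which makes the total exactly 1. *)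
  exists (N1 + N2)%nat, ((one, 1 - lsum v gs) :: l); split; [|split].
  - intros av [<-|Hav]; cbn [fst snd].
    + split; [apply (wle_mono _ 0); [lia|apply wle_one]|lra].
    + apply in_map_iff in Hav as [g [<- Hg]]; split; [now apply HN2|apply Hpos, Hx].
  - simpl; unfold l; rewrite lsum_map; simpl; change (fun g => v g) with v; lra.
  - intros p Hp lz Hlz.
    assert (Evm : forall g, vertex_mass m p (mul g p) = m (fun _ => p, g)).
    { intros g; unfold vertex_mass; now gsimp. }
    assert (Hclose : forall g, In g gs -> Rabs (m (fun _ => p, g) - v g) <= η).
    { intros g Hg; left; apply (HN1 g (fun _ => p)); auto; [apply unit_const|].
      apply (unit_iso_mono x (fun _ => p) N1 (N1 + N2)); auto; [apply unit_const|lia]. }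
    set (lp := map (fun av : G * R => (mul (fst av) p, snd av)) l).
    apply Rle_trans with (lsum (fun z => Rabs (vertex_mass m p z - pmass (ceq H) lp z) +
      (if dec (ceq H (mul one p) z) then 1 - lsum v gs else 0)) lz).
    { apply lsum_le; intros z _; unfold push, pmass; cbn [map lsum fst snd]; fold lp.
      fold (pmass (ceq H) lp z).
      set (c := if dec _ then _ else _).
      assert (Hc : 0 <= c) by (unfold c; destruct (dec _); lra).
      replace (vertex_mass m p z - (c + pmass (ceq H) lp z))
        with (vertex_mass m p z - pmass (ceq H) lp z - c) by ring.
      eapply Rle_trans; [apply Rabs_triang|]; rewrite Rabs_Ropp, (Rabs_pos_eq c); lra. }
    rewrite lsum_plus.
    assert (Hatom := lsum_atom_le (ceq H) (mul one p) (1 - lsum v gs) lz Hlz ltac:(lra)).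
    assert (Hlp : separated (ceq H) (map fst lp)).
    { unfold lp, l; rewrite !map_map; cbn [fst].
      apply (separated_map (same_arrow x)); [|exact Hgs].
      intros g h Hg Hh Hc.
      apply (same_arrow_level x g h (N1 + N2) (N1 + N2) (N1 + N2)); auto; [lia|].
      refine (proj1 (iso_vertices _ _ _ g h _ _ Hp (HN2 g Hg) (HN2 h Hh) _) Hc); lia. }
    assert (Happ := pmass_approx (ceq H) (vertex_mass m p) lp lz (vertex_mass_nonneg p)
      (fun z z' => vertex_mass_ceq p p z z' (reflexivity p)) (vertex_mass_le_1 p) Hlp Hlz).
    unfold lp, l in Happ; rewrite !lsum_map in Happ; cbn [fst snd] in Happ.
    fold l in Happ; fold lp in Happ.
    assert (Hd : lsum (fun g => Rabs (vertex_mass m p (mul g p) - v g)) gs <= δ / 4).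
    { apply Rle_trans with (lsum (fun _ => η) gs).
      - apply lsum_le; intros g Hg; rewrite Evm; auto.
      - rewrite lsum_const; unfold η.
        replace (δ / 4) with ((INR (length gs) + 1) * (δ / 4 / (INR (length gs) + 1))) at 2
          by (field; lra).
        apply Rmult_le_compat_r; [left; exact Hη|lra]. }
    assert (Hlow : lsum v gs - lsum (fun g => vertex_mass m p (mul g p)) gs <= δ / 4).
    { rewrite <- lsum_minus; eapply Rle_trans; [|exact Hd].
      apply lsum_le; intros g _; rewrite Rabs_minus_sym; apply Rle_abs. }
    (* Four errors of at most [δ / 4]: the added atom, the differences at the atoms, and for the
       mass off the atoms the uncaptured mass and the drift [Hlow]. *)
    lra.
Qed.

Lemma approximable_uniform δ : 0 < δ ->
  exists N, forall c, exists l, approximable δ l N c.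
Proof.
  intros Hδ; apply (units_compact (fun N c => exists l, approximable δ l N c)).
  - intros n u v Huv [l [Hl [H1 Hp]]]; exists l; split; [exact Hl|split; [exact H1|]].
    intros p Hpv; apply Hp; now rewrite Huv.
  - intros n u [l [Hl [H1 Hp]]]; exists l; split; [|split; [exact H1|]].
    + intros av Hav; destruct (Hl av Hav); split; [apply (wle_mono _ n); auto|assumption].
    + intros p Hpu; apply Hp; now apply (iso_mono n (S n)); auto.
  - intros x Hx; now apply approximable_at.
Qed.

End VertexMass.

Lemma sqr_sqrt_diff_le a b : 0 <= a -> 0 <= b -> (sqrt a - sqrt b) ^ 2 <= Rabs (a - b).
Proof.
  assert (Hle : forall a b, 0 <= b -> b <= a -> (sqrt a - sqrt b) ^ 2 <= a - b).
  (* For [b <= a] one factor of the square is enlarged to [sqrt a + sqrt b]. *)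
  { clear a b; intros a b Hb Hab; assert (Hs := sqrt_le_1_alt b a Hab).
    assert (Ha := sqrt_sqrt a ltac:(lra)); assert (Hb' := sqrt_sqrt b Hb).
    assert (Hp := sqrt_pos b); nra. }
  intros Ha Hb; destruct (Rle_or_lt b a) as [Hab|Hab].
  - rewrite Rabs_pos_eq by lra; auto.
  - rewrite Rabs_minus_sym, Rabs_pos_eq by lra.
    replace ((sqrt a - sqrt b) ^ 2) with ((sqrt b - sqrt a) ^ 2) by ring; apply Hle; lra.
Qed.

Lemma amenable_property_A : topologically_amenable Q H -> local_property_A Q H.
Proof.
  intros HA n Hn.
  assert (Hn0 : 0 < INR n) by (apply lt_0_INR; lia).
  (* A third each for approximate invariance and for the approximations at the two vertices. *)
  set (δ := (1 / INR n) ^ 2 / 3).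
  assert (Hδ : 0 < δ).
  { apply Rdiv_lt_0_compat; [apply pow_lt, Rdiv_lt_0_compat|]; lra. }
  destruct (HA _ (bisections_compact (words n)) δ Hδ) as [m [Hm Hinv]].
  destruct (approximable_uniform m Hm δ Hδ) as [N HN].
  (* One vertex per class of level [N], so that isomorphic vertices use the same list of weights. *)
  set (rep := fun u => epsilon (inhabits one) (iso_cls Q H N u)).
  assert (Hrep : forall u, iso_cls Q H N u (rep u)).
  { intros u; apply epsilon_spec; exists u; reflexivity. }
  assert (Erep : forall u v, iso_cls Q H N u v -> rep u = rep v).
  { intros u v Huv; unfold rep; f_equal; extensionality w.
    apply propositional_extensionality; now rewrite Huv. }
  destruct (choice _ HN) as [lc Hlc].
  set (μ := fun u => push (lc (rep u)) u).
  assert (Hμpos : forall u z, 0 <= μ u z).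
  { intros u z; apply pmass_nonneg; intros av Hav.
    apply in_map_iff in Hav as [bv [<- Hbv]].
    exact (proj2 (proj1 (Hlc (rep u)) bv Hbv)). }
  assert (Hclose : forall u lz, separated (ceq H) lz ->
    lsum (fun z => Rabs (vertex_mass m u z - μ u z)) lz <= δ).
  { intros u lz Hlz; now apply (Hlc (rep u)). }
  (* The added half makes the radius positive even for [N = 0]; distances being integers, the balls
     do not change. *)
  exists (fun u z => sqrt (μ u z)), (INR N + / 2).
  assert (Hfloor : forall k, INR k <= INR N + / 2 <-> (k <= N)%nat).
  { intros k; split; intros Hk.
    - apply Nat.lt_succ_r, INR_lt; rewrite S_INR; lra.
    - apply le_INR in Hk; lra. }
  assert (Hball : forall u z, in_ball Q H (INR N + / 2) u z <-> in_ball Q H (INR N) u z).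
  { intros u z; unfold in_ball; split; intros [k [Hk Hd]]; exists k; split; auto.
    - now apply le_INR, Hfloor.
    - now apply Hfloor, INR_le. }
  assert (Hin : forall u g, wle g N -> in_ball Q H (INR N) u (mul g u)).
  { intros u g Hg; apply in_ball_iff; exists g, N; repeat split; [lra|exact Hg|reflexivity]. }
  split; [|split; [|split; [|split; [|split; [|split]]]]].
  - generalize (pos_INR N); lra.
  - intros x x' Hxx y; f_equal; unfold μ; rewrite (Erep x x') by now apply ceq_iso.
    apply push_eq; intros av _; now rewrite Hxx.
  - intros x y y' Hyy; f_equal; apply push_eq; intros av _; now rewrite Hyy.
  - intros x; exists 1; split; [|apply sqrt_1].
    replace (fun z => sqrt (μ x z) ^ 2) with (μ x)
      by (extensionality z; symmetry; now apply pow2_sqrt).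
    destruct (Hlc (rep x)) as [Hl [H1 _]].
    rewrite <- H1; unfold μ, push.
    replace (lsum snd (lc (rep x)))
      with (lsum snd (map (fun av => (mul (fst av) x, snd av)) (lc (rep x))))
      by now rewrite lsum_map.
    apply (sum_pmass (ceq H)); intros av Hav; apply in_map_iff in Hav as [bv [<- Hbv]].
    exact (proj2 (Hl bv Hbv)).
  - intros x y [w [Hw [Hwl Hc]]].
    destruct (sum_nonneg_bounded (ceq H) (fun _ => True)
      (fun z => (sqrt (μ x z) - sqrt (μ y z)) ^ 2) ((1 / INR n) ^ 2)) as [s [Hs Hsb]].
    + intros lz _ Hlz.
      apply Rle_trans with (lsum (fun z =>
        (Rabs (vertex_mass m (mul (prod_word w) x) z - vertex_mass m x z) +
         Rabs (vertex_mass m x z - μ x z)) + Rabs (vertex_mass m y z - μ y z)) lz).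
      * apply lsum_le; intros z _; eapply Rle_trans; [now apply sqr_sqrt_diff_le|].
        rewrite (vertex_mass_ceq m Hm _ _ z z Hc (reflexivity z)).
        unfold Rabs; repeat destruct (Rcase_abs _); lra.
      * rewrite !lsum_plus.
        assert (B1 := vertex_mass_translate m x (prod_word w) lz δ n Hinv
          ltac:(exists w; auto) Hlz).
        assert (B2 := Hclose x lz Hlz); assert (B3 := Hclose y lz Hlz).
        unfold δ in B1, B2, B3; lra.
    + exists s; split; [exact Hs|]; rewrite <- (sqrt_pow2 (1 / INR n)).
      * now apply sqrt_le_1_alt.
      * left; apply Rdiv_lt_0_compat; lra.
  - intros x z Hz; rewrite <- sqrt_0; f_equal; unfold μ, push, pmass; rewrite lsum_map.
    apply (lsum_indicator_none (fun av => ceq H (mul (fst av) x) z) snd).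
    intros av Hav Hc; apply Hz, Hball, in_ball_iff.
    exists (fst av), N; repeat split; [lra|now apply (Hlc (rep x))|exact Hc].
  - intros x y θ Hθ z Hz; f_equal.
    assert (HθN : root_label_iso Q H (INR N) x y θ).
    { destruct Hθ as [A1 [A2 [A3 [A4 [A5 A6]]]]].
      split; [intros; apply A1; auto; now apply Hball|].
      split; [intros; apply Hball, A2; now apply Hball|].
      split; [exact A3|].
      split; [intros; apply A4; auto; now apply Hball|].
      split; [|intros; apply A6; auto; now apply Hball].
      intros b Hb; destruct (A5 b) as [a [Ha Hab]]; [now apply Hball|].
      exists a; split; [now apply Hball|exact Hab]. }
    (* Both vertices have the same [rep], hence the same atoms [g], and θ carries [g x] to [g y]. *)
    apply Hball in Hz; unfold μ; rewrite <- (Erep x y) by (exists θ; exact HθN).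
    apply push_eq; intros av Hav.
    assert (Hg : wle (fst av) N) by now apply (Hlc (rep x)).
    assert (Hw : ceq H (θ (mul (fst av) x)) (mul (fst av) y)).
    { destruct Hg as [w [Hw [Hl <-]]]; now apply (root_label_iso_word N). }
    destruct HθN as [Hwd [_ [_ [Hinj _]]]].
    rewrite <- Hw; split; [apply Hinj|apply Hwd]; auto.
Qed.

End Schreier.

Theorem theorem5p3 (Γ : grp) (Q : list Γ) (Z : (Γ -> Prop) -> Prop) (H : Γ -> Prop) :
  finite_symmetric_generating Q ->
  URS Z -> Z H ->
  (local_property_A Q H <-> topologically_amenable Q H).
Proof.
  intros HQ [HZ _] HH; apply HZ in HH; split.
  - now apply property_A_amenable.
  - now apply amenable_property_A.
Qed.
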